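(* Let $G=(V,E)$ be a finite, simple, connected graph. The following are equivalent: (i) $G$ is reflective; (ii) $G$ is a cocktail party graph, a Johnson graph, a halved cube, the Schläfli graph, the Gosset graph, or a cartesian product of (finitely many) graphs from this list.
   Context: $d$ is the combinatorial distance. For adjacent $x\sim y$ let $V_x^y=\{v: d(v,x)<d(v,y)\}$ and $V^{xy}=\{v:d(v,x)=d(v,y)\}$. A map $\phi:V\to V$ is a reflection from $x$ to $y$ if: $\phi$ is a graph automorphism; $\phi\circ\phi=\mathrm{id}$; $\phi(x)=y$; the set of edges between $V_x^y$ and $V_y^x$ is exactly $\{\{x',\phi(x')\}: x'\in V_x^y\}$; and $\phi(z)=z$ for all $z\in V^{xy}$. $G$ is reflective if for every edge $x\sim y$ there is a reflection from $x$ to $y$. Cocktail party graph $CP(k)$: $K_{2k}$ minus a perfect matching. Johnson graph $J(n,k)$: $k$-subsets of an $n$-set, adjacent iff they share $k-1$ elements. Halved cube: binary strings of length $n$ of even weight, adjacent iff they differ in exactly two coordinates. Schläfli graph: the strongly regular graph with parameters $(27,16,10,8)$. Gosset graph: the 56-vertex, 27-regular distance regular graph (1-skeleton of the $3_{21}$ polytope). Cartesian product: $(a,b)\sim(a',b')$ iff ($a=a'$, $b\sim b'$) or ($a\sim a'$, $b=b'$). *)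

(* Defs.v *)
(* Finite simple graphs are symmetric irreflexive relations
   on a finType. *)
From mathcomp Require Import all_boot.
Set Implicit Arguments. Unset Strict Implicit. Unset Printing Implicit Defensive.

Section GraphDefs.
Variables (T : finType) (e : rel T).

Definition gconnected : Prop :=
  (exists x : T, True) /\ forall x y : T, connect e x y.

Fixpoint within (n : nat) (x y : T) : bool :=
  match n with
  | 0 => x == y
  | n'.+1 => within n' x y || [exists z, within n' x z && e z y]
  end.

(* combinatorial distance: least n with a walk of length <= n
   (equal to #|T| when y is unreachable from x, which does not happen
   in a connected graph) *)
Definition gdist (x y : T) : nat :=
  find (fun n => within n x y) (iota 0 #|T|).

Definition Vclose (x y : T) : {set T} := [set v | gdist v x < gdist v y].
Definition Vequi (x y : T) : {set T} := [set v | gdist v x == gdist v y].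

Definition is_automorphism (phi : T -> T) : Prop :=
  bijective phi /\ forall u v, e (phi u) (phi v) = e u v.

Definition is_reflection (x y : T) (phi : T -> T) : Prop :=
  [/\ is_automorphism phi,
      (forall v, phi (phi v) = v),
      phi x = y,
      ((forall u v, u \in Vclose x y -> v \in Vclose y x -> e u v -> v = phi u) /\
       (forall u, u \in Vclose x y -> phi u \in Vclose y x /\ e u (phi u))) &
      (forall z, z \in Vequi x y -> phi z = z)].

Definition reflective : Prop :=
  forall x y : T, e x y -> exists phi : T -> T, is_reflection x y phi.

End GraphDefs.

Record fgraph := FGraph { fvert : finType; fadj : rel fvert }.

Definition giso (G H : fgraph) : Prop :=
  exists f : fvert G -> fvert H,
    bijective f /\ forall u v, @fadj H (f u) (f v) = @fadj G u v.

(* cocktail party graph CP(k): K_{2k} minus the perfect matching {(i,false),(i,true)} *)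
Definition cocktail (k : nat) : fgraph :=
  @FGraph ('I_k * bool)%type (fun u v => u.1 != v.1).

Definition johnson_vert (n k : nat) := {A : {set 'I_n} | #|A| == k}.
Definition johnson (n k : nat) : fgraph :=
  @FGraph (johnson_vert n k)
    (fun A B => #|val A :&: val B|.+1 == k).

Definition hcube_vert (n : nat) := {x : {ffun 'I_n -> bool} | ~~ odd #|[set i | x i]|}.
Definition halved_cube (n : nat) : fgraph :=
  @FGraph (hcube_vert n)
    (fun x y => #|[set i | val x i != val y i]| == 2).

(* Gosset graph: two copies of the 2-subsets of an 8-set; within a copy
   adjacent iff they meet in one point, across copies iff disjoint
   (= vectors +-(3,3,-1,...,-1) in R^8, adjacent iff inner product 8) *)
Definition gosset_vert := ({A : {set 'I_8} | #|A| == 2} * bool)%type.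
Definition gosset_adj (u v : gosset_vert) : bool :=
  if u.2 == v.2 then #|val u.1 :&: val v.1| == 1
  else [disjoint val u.1 & val v.1].
Definition gosset : fgraph := @FGraph gosset_vert gosset_adj.

(* Schläfli graph: the local graph of the Gosset graph, i.e. the subgraph
   induced on the 27 neighbours of a fixed vertex; it is the (27,16,10,8)
   strongly regular graph *)
Definition gosset_base : gosset_vert.
Proof.
  refine (exist _ [set (@Ordinal 8 0 isT); (@Ordinal 8 1 isT)] _, false).
  by rewrite cards2.
Defined.
Definition schlafli_vert := {v : gosset_vert | gosset_adj gosset_base v}.
Definition schlafli : fgraph :=
  @FGraph schlafli_vert (fun u v => gosset_adj (val u) (val v)).

Definition gprod (G H : fgraph) : fgraph :=
  @FGraph (fvert G * fvert H)%type
    (fun u v => ((u.1 == v.1) && @fadj H u.2 v.2) || (@fadj G u.1 v.1 && (u.2 == v.2))).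

Definition gK1 : fgraph := @FGraph unit (fun _ _ => false).

Definition gprod_list (s : seq fgraph) : fgraph := foldr gprod gK1 s.

Inductive basic_code :=
| CodeCP of nat
| CodeJ of nat & nat
| CodeHalved of nat
| CodeSchlafli
| CodeGosset.

Definition graph_of_code (c : basic_code) : fgraph :=
  match c with
  | CodeCP k => cocktail k
  | CodeJ n k => johnson n k
  | CodeHalved n => halved_cube n
  | CodeSchlafli => schlafli
  | CodeGosset => gosset
  end.

(* Main.v *)
(** A reflective graph carries the distance function q = d and, for every edge
    xy, an isometric involution exchanging the two half-spaces of xy. Such data
    (T, e, q), now with T possibly disconnected, are inherited by the
    neighbourhood of a vertex and by unions of components; conversely, on a
    connected graph q is forced to be the distance. They arise from any
    embedding in Z^I with |u - v|^2 = 2c q(u, v) which is closed under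
    completing w, x, y to the parallelogram w + y - x when w is closer to x than
    to an adjacent y; this covers the basic graphs, and products add the q's.

    For the converse, a connected reflective graph is determined by the graph
    induced on the neighbours of one vertex p: a vertex v is determined by the
    function a |-> q(v, a) - q(v, p) on the neighbours a of p, and the
    reflections s_{pa} act on these functions by a formula that only involves
    the local graph. It remains to realise every (T, e, q) with q <= 2 as a
    local graph of a product of basic graphs. By induction each component is a
    product of basic graphs of diameter at most 2, hence K_a x K_b, CP(k),
    J(n,2), the halved 5-cube or the Schläfli graph, and these are the local
    graphs of J(a+b,a), CP(k+1), the halved n-cube, the Schläfli graph and the
    Gosset graph. *)
Require Import Defs.
From mathcomp Require Import all_boot perm all_algebra.
From mathcomp Require Import zify ring.
Set Implicit Arguments. Unset Strict Implicit. Unset Printing Implicit Defensive.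

(** * Distance functions with reflections *)

(** The matching between the half-spaces is stated from the side of [x]; the side of [y] follows by
    applying the involution [s]. Once adjacency means [q = 1], the isometry condition makes [s] an
    automorphism. *)
Definition qreflection (T : finType) (e : rel T) (q : T -> T -> nat) x y s :=
  [/\ involutive s, (forall u v, q (s u) (s v) = q u v), s x = y,
      (forall u, q u x = q u y -> s u = u) &
      (forall u, q u x < q u y ->
         e u (s u) /\ forall v, e u v -> q v y < q v x -> v = s u)].

(* In a connected graph q is the distance; disconnected graphs are allowed so
   that local graphs are covered, and there q keeps its ambient values. *)
Record qreflective (T : finType) (e : rel T) (q : T -> T -> nat) : Prop :=
  QReflective {
    qr_eq0 : forall u v, (q u v == 0) = (u == v);
    qr_eq1 : forall u v, (q u v == 1) = e u v;
    qr_sym : forall u v, q u v = q v u;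
    qr_lip : forall x y w, e x y -> q w x <= (q w y).+1;
    qr_refl : forall x y, e x y -> exists s, qreflection e q x y s }.

(** For [qreflective] data this is equivalent to connectedness. *)
Definition geodesic (T : finType) (e : rel T) (q : T -> T -> nat) :=
  forall u v, u != v -> exists2 w, e u w & (q w v).+1 = q u v.

(** * Walks of bounded length and the graph distance *)

Section Within.
Variables (T : finType) (e : rel T).

Lemma withinS n x y : within e n x y -> within e n.+1 x y.
Proof. by move=> h /=; rewrite h. Qed.

Lemma within_leq m n x y : m <= n -> within e m x y -> within e n x y.
Proof.
move=> /subnK <-; elim: (n - m) => // k IH h; rewrite addSn.
exact: withinS (IH h).
Qed.

Lemma within_rstep n x y z : within e n x y -> e y z -> within e n.+1 x z.
Proof. by move=> h1 h2 /=; apply/orP; right; apply/existsP; exists y; rewrite h1. Qed.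

Lemma within_trans m n x y z :
  within e m x y -> within e n y z -> within e (m + n) x z.
Proof.
elim: n z => [|n IH] z h /=; first by move=> /eqP<-; rewrite addn0.
rewrite addnS => /orP[/(IH _ h)/withinS //|/existsP[w /andP[/(IH _ h) h1 h2]]].
exact: within_rstep h1 h2.
Qed.

Lemma within1 x y : e x y -> within e 1 x y.
Proof. by move=> h; exact: (@within_rstep 0 x x y (eqxx x) h). Qed.

Lemma within_sym n x y : symmetric e -> within e n x y -> within e n y x.
Proof.
move=> es; elim: n y => [|n IH] y /=; first by rewrite eq_sym.
move=> /orP[/IH-> //|/existsP[w /andP[/IH h1 h2]]].
by apply: (@within_trans 1 n _ w) => //; apply: within1; rewrite es.
Qed.

(** A repetition-free path has at most [#|T|] vertices, so the bounded search in [gdist] is long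
    enough. *)
Lemma connect_within x y : connect e x y -> exists2 n, n < #|T| & within e n x y.
Proof.
move=> /connectP[p0 hp0 ->]; case/shortenP: hp0 => p hp up _.
exists (size p); first by have := max_card (mem (x :: p)); rewrite (card_uniqP up).
elim/last_ind: p hp {up} => [|p z IH]; first by rewrite /= eqxx.
rewrite rcons_path last_rcons size_rcons => /andP[/IH]; exact: within_rstep.
Qed.

Lemma within_homo n x y (f : T -> T) :
  (forall u v, e u v -> f u = f v \/ e (f u) (f v)) ->
  within e n x y -> within e n (f x) (f y).
Proof.
move=> hf; elim: n y => [|n IH] y /=; first by move=> /eqP->.
move=> /orP[/IH-> //|/existsP[w /andP[/IH h1 /hf[<-|h2]]]]; first by rewrite h1.
exact: within_rstep h1 h2.
Qed.

Lemma gdistP x y n : connect e x y -> (gdist e x y <= n) = within e n x y.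
Proof.
move=> /connect_within[m hm hw]; rewrite /gdist.
have hhas : has (fun n => within e n x y) (iota 0 #|T|).
  by apply/hasP; exists m => //; rewrite mem_iota.
have hf := nth_find 0 hhas; have := hhas; rewrite has_find size_iota => hlt.
move: hf; rewrite nth_iota // add0n => hf.
apply/idP/idP => [le|hn]; first exact: within_leq le hf.
rewrite leqNgt; apply/negP => lt.
have := before_find 0 lt; rewrite nth_iota ?add0n ?hn //; exact: ltn_trans lt hlt.
Qed.

End Within.

(** * Reflections, folding, and [q] as the distance on components *)

Section QTheory.
Variables (T : finType) (e : rel T) (q : T -> T -> nat).
Hypothesis Q : qreflective e q.

Lemma qr_esym : symmetric e.
Proof. by move=> u v; rewrite -!(qr_eq1 Q) (qr_sym Q). Qed.

Lemma qr_eirr : irreflexive e.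
Proof. by move=> u; rewrite -(qr_eq1 Q) (eqP (_ : q u u == 0)) // (qr_eq0 Q). Qed.

Lemma qr_xx u : q u u = 0.
Proof. by apply/eqP; rewrite (qr_eq0 Q). Qed.

Lemma qr_edge u v : e u v -> q u v = 1.
Proof. by move=> h; apply/eqP; rewrite (qr_eq1 Q). Qed.

Lemma qr_lipr x y w : e x y -> q x w <= (q y w).+1.
Proof. by rewrite !(qr_sym Q _ w); exact: qr_lip. Qed.

Section Refl.
Variables (x y : T) (s : T -> T).
Hypothesis S : qreflection e q x y s.

Lemma qs_inv : involutive s. Proof. by case: S. Qed.
Lemma qs_iso u v : q (s u) (s v) = q u v. Proof. by case: S. Qed.
Lemma qs_x : s x = y. Proof. by case: S. Qed.
Lemma qs_y : s y = x. Proof. by rewrite -qs_x qs_inv. Qed.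
Lemma qs_fix u : q u x = q u y -> s u = u. Proof. by case: S => _ _ _ + _; apply. Qed.
Lemma qs_edge u v : e (s u) (s v) = e u v.
Proof. by rewrite -!(qr_eq1 Q) qs_iso. Qed.
Lemma qs_sx u : q (s u) x = q u y. Proof. by rewrite -{1}qs_y qs_iso. Qed.
Lemma qs_sy u : q (s u) y = q u x. Proof. by rewrite -{1}qs_x qs_iso. Qed.

Lemma qs_move u : q u x != q u y -> e u (s u).
Proof.
case: S => _ _ _ _ h; rewrite neq_ltn => /orP[/h[]//|lt].
have [|] := h (s u); first by rewrite qs_sx qs_sy.
by rewrite qs_inv qr_esym.
Qed.

Lemma qs_cross u v : q u x < q u y -> q v y < q v x -> e u v -> v = s u.
Proof. by case: S => _ _ _ _ h /h[_ h1] h2 h3; exact: h1. Qed.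

Lemma qs_fixP u : s u = u -> q u x = q u y.
Proof. by move=> h; rewrite -{1}h qs_sx. Qed.

Lemma within_qs n u v : within e n u v -> within e n (s u) (s v).
Proof. by apply: within_homo => a b h; right; rewrite qs_edge. Qed.

Lemma within_fold n u v : within e n u v -> q u y <= q u x -> q v x < q v y ->
  within e n u (s v).
Proof.
(* Folding: an edge is mapped to an edge, or collapses if it joins the two
   half-spaces. *)
pose f v := if q v x < q v y then s v else v.
move=> h hu hv.
have := @within_homo _ _ n u v f; rewrite /f hv ltnNge hu /=; apply => // a b hab.
case: ltnP => ha; case: ltnP => hb; last by right.
- by right; rewrite qs_edge.
- have [hb'|hb'] := ltnP (q b y) (q b x).
    by left; rewrite (qs_cross ha hb' hab).
  right; rewrite -(@qs_fix b) ?qs_edge //; lia.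
- have [ha'|ha'] := ltnP (q a y) (q a x).
    by left; apply: qs_cross hb ha' _; rewrite qr_esym.
  right; rewrite -(@qs_fix a) ?qs_edge //; lia.
Qed.

End Refl.

(** Let [wz] be the last edge of a shortest walk from [u] to [z], so that [q u w = n] by induction.
    If [q u z = q u w], the reflection along [wz] fixes [u] and carries the walk ending at [w] to
    one ending at [z]; if [q u z < q u w], folding does the same. Both contradict minimality, so
    [q u z] exceeds [n], and the Lipschitz bound gives equality. *)
Lemma qr_within_min n u v : within e n.+1 u v -> ~~ within e n u v -> q u v = n.+1.
Proof.
elim/ltn_ind: n v => n IH z h1 h2.
have /existsP[w /andP[hw hwz]] : [exists w, within e n u w && e w z].
  by move: h1 => /=; rewrite (negPf h2).
have qw : q u w = n.
  case: n IH h1 h2 hw => [|n] IH h1 h2 hw; first by move: hw => /= /eqP->; exact: qr_xx.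
  apply: IH => //; apply: contra h2 => h; exact: within_rstep h hwz.
have := qr_lip Q u hwz; have := @qr_lip _ _ _ Q z w u.
rewrite qr_esym hwz => /(_ isT) l1 l2.
have [s hs] := qr_refl Q hwz.
have [E|ne] := q u w =P q u z.
  have := within_qs hs hw; rewrite (qs_fix hs E) (qs_x hs) => h3.
  by rewrite h3 in h2.
have [lt|?] := ltnP (q u z) (q u w); last lia.
have := within_fold hs hw (ltnW lt).
rewrite (qr_xx w) (qr_edge hwz) (qs_x hs) => /(_ isT) h3; by rewrite h3 in h2.
Qed.

Lemma qr_within n u v : connect e u v -> (q u v <= n) = within e n u v.
Proof.
move=> huv; rewrite -gdistP //; congr (_ <= _).
have [m hm hw] := connect_within huv.
have : within e (gdist e u v) u v by rewrite -gdistP.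
case E: (gdist e u v) => [|k]; first by move=> /= /eqP->; exact: qr_xx.
by move=> h; apply: qr_within_min => //; rewrite -gdistP // E ltnn.
Qed.

Lemma qr_gdist u v : connect e u v -> gdist e u v = q u v.
Proof.
by move=> h; apply/eqP; rewrite eqn_leq gdistP // -qr_within // leqnn qr_within // -gdistP // leqnn.
Qed.

Lemma qr_step u v : connect e u v -> u != v -> exists2 w, e u w & (q w v).+1 = q u v.
Proof.
move=> huv ne; case E: (q u v) => [|n].
  by move: E => /eqP; rewrite (qr_eq0 Q) (negPf ne).
have : within e n.+1 v u by apply: within_sym qr_esym _; rewrite -qr_within // E.
move=> /= /orP[|/existsP[w /andP[hw hwu]]].
  by move=> /within_sym-/(_ qr_esym); rewrite -qr_within // E ltnn.
have le : q w v <= n.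
  rewrite qr_within; first exact: within_sym qr_esym hw.
  by apply: connect_trans huv; exact: connect1.
exists w; first by rewrite qr_esym.
have := @qr_lipr u w v; rewrite qr_esym E => /(_ hwu); lia.
Qed.

Lemma qr_connected_geodesic : (forall u v, connect e u v) -> geodesic e q.
Proof. by move=> h u v; exact: qr_step. Qed.

Lemma geodesic_connect : geodesic e q -> forall u v, connect e u v.
Proof.
move=> G u v; move E: (q u v) => n; elim: n u E => [|n IH] u.
  by move=> /eqP; rewrite (qr_eq0 Q) => /eqP->; exact: connect0.
move=> E; have [|w ew qw] := G u v.
  by rewrite -(qr_eq0 Q) E.
apply: connect_trans (connect1 ew) (IH _ _); lia.
Qed.

Lemma qreflective_reflective : (forall u v, connect e u v) -> reflective e.
Proof.
move=> C x y exy; have [s hs] := qr_refl Q exy; exists s.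
have E u v := qr_gdist (C u v).
split.
- split; first by exists s; exact: (qs_inv hs).
  exact: (qs_edge hs).
- exact: (qs_inv hs).
- exact: (qs_x hs).
- split=> [u v|u]; rewrite !inE !E; first exact: (qs_cross hs).
  move=> h; rewrite (qs_sx hs) (qs_sy hs); split=> //.
  by apply: (qs_move hs); rewrite ltn_eqF.
- by move=> z; rewrite inE !E => /eqP; exact: qs_fix.
Qed.

End QTheory.

Lemma reflective_qreflective (T : finType) (e : rel T) :
  symmetric e -> irreflexive e -> (forall u v, connect e u v) ->
  reflective e -> qreflective e (gdist e).
Proof.
move=> es ei C R.
have dC u v : gdist e u v = gdist e v u.
  by apply/eqP; rewrite eqn_leq !gdistP //; apply/andP; split;
     apply: within_sym => //; rewrite -gdistP.
split=> //.
- by move=> u v; rewrite -leqn0 gdistP.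
- move=> u v; rewrite eqn_leq gdistP // ltnNge gdistP //=.
  apply/idP/idP => [/andP[/orP[->//|/existsP[w /andP[/eqP-> //]]]]|h].
  apply/andP; split; first by apply/orP; right; apply/existsP; exists u; rewrite eqxx.
  by apply: contraTneq h => ->; rewrite ei.
- move=> x y w h; rewrite gdistP //; apply: within_rstep (_ : e y x); last by rewrite es.
  by rewrite -gdistP.
- move=> x y exy; have [s [[sb se] si sx [h1 h2] h3]] := R x y exy.
  have iso u v : gdist e (s u) (s v) = gdist e u v.
    have le a b : gdist e (s a) (s b) <= gdist e a b.
      rewrite gdistP //; apply: (@within_homo _ _ _ a b s); last by rewrite -gdistP.
      by move=> c d; right; rewrite se.
    by apply/eqP; rewrite eqn_leq le /= -{1}(si u) -{1}(si v) le.
  exists s; split=> //; first by move=> u h; apply: h3; rewrite inE h.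
  move=> u hu; have hu' : u \in Vclose e x y by rewrite inE.
  split; first by case: (h2 u hu').
  by move=> v huv hv; apply: h1 => //; rewrite inE.
Qed.

(** * Substructures, products, and uniqueness from the local graph *)

Record localiso (U : finType) (eU : rel U) (T : finType) (e : rel T) (p : T)
    (psi : U -> T) : Prop := LocalIso {
  li_inj : injective psi;
  li_adj : forall a, e p (psi a);
  li_sur : forall b, e p b -> exists a, b = psi a;
  li_edge : forall a b, e (psi a) (psi b) = eU a b }.

(** As [q] keeps its ambient values, a reflection restricts as soon as it preserves [P]. *)
Lemma qreflective_sub (T : finType) (e : rel T) q (P : pred T) :
  qreflective e q ->
  (forall x y s, P x -> P y -> e x y -> qreflection e q x y s ->
     forall u, P u -> P (s u)) ->
  @qreflective {x | P x} (fun u v => e (val u) (val v))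
     (fun u v => q (val u) (val v)).
Proof.
move=> Q hP; split.
- by move=> u v; rewrite (qr_eq0 Q) val_eqE.
- by move=> u v; rewrite (qr_eq1 Q).
- by move=> u v; rewrite (qr_sym Q).
- by move=> x y w; exact: qr_lip.
- move=> [x hx] [y hy] /= exy; have [s hs] := qr_refl Q exy.
  have st u : P u -> P (s u) by exact: hP hx hy exy hs u.
  exists (fun u => exist _ (s (val u)) (st _ (valP u))); split.
  + by move=> u; apply: val_inj; exact: (qs_inv hs).
  + by move=> u v; exact: (qs_iso hs).
  + by apply: val_inj; exact: (qs_x hs).
  + by move=> u hu; apply: val_inj; exact: (qs_fix hs).
  + move=> u hu; split; first by apply: (qs_move Q hs); rewrite ltn_eqF.
    by move=> v huv hv; apply: val_inj; exact: (qs_cross hs).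
Qed.

Lemma qreflective_iso (T T' : finType) (e : rel T) (e' : rel T') q' (f : T -> T') :
  bijective f -> (forall u v, e' (f u) (f v) = e u v) ->
  qreflective e' q' -> qreflective e (fun u v => q' (f u) (f v)).
Proof.
move=> [g fK gK] fe Q; split.
- by move=> u v; rewrite (qr_eq0 Q) (can_eq fK).
- by move=> u v; rewrite (qr_eq1 Q).
- by move=> u v; rewrite (qr_sym Q).
- by move=> x y w; rewrite -fe; exact: qr_lip.
- move=> x y; rewrite -fe => exy; have [s hs] := qr_refl Q exy.
  exists (fun u => g (s (f u))); split.
  + by move=> u; rewrite gK (qs_inv hs).
  + by move=> u v; rewrite !gK; exact: (qs_iso hs).
  + by rewrite (qs_x hs).
  + by move=> u hu; rewrite (qs_fix hs).
  + move=> u hu; rewrite -fe gK; split; first by apply: (qs_move Q hs); rewrite ltn_eqF.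
    by move=> v; rewrite -fe => huv hv; rewrite -(qs_cross hs hu hv huv).
Qed.

(** An edge of the product changes one coordinate, and its reflection acts on that coordinate
    alone. *)
Lemma qreflective_prod (G H : Defs.fgraph) q1 q2 :
  qreflective (@fadj G) q1 -> qreflective (@fadj H) q2 ->
  qreflective (@fadj (gprod G H)) (fun u v => q1 u.1 v.1 + q2 u.2 v.2).
Proof.
move=> Q1 Q2; split.
- by move=> [a b] [c d]; rewrite addn_eq0 (qr_eq0 Q1) (qr_eq0 Q2).
- move=> [a b] [c d] /=; rewrite -(qr_eq1 Q1) -(qr_eq1 Q2) -(qr_eq0 Q1) -(qr_eq0 Q2); lia.
- by move=> [a b] [c d]; rewrite (qr_sym Q1) (qr_sym Q2).
- move=> [a b] [c d] [g h] /= /orP[/andP[/eqP-> E]|/andP[E /eqP->]].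
    by have := qr_lip Q2 h E; lia.
  by have := qr_lip Q1 g E; lia.
- move=> [a b] [c d] /= /orP[/andP[/eqP-> E]|/andP[E /eqP->]].
    have [s hs] := qr_refl Q2 E; exists (fun u => (u.1, s u.2)); split=> /=.
    + by move=> [u v] /=; rewrite (qs_inv hs).
    + by move=> u v; rewrite (qs_iso hs).
    + by rewrite (qs_x hs).
    + by move=> [u v] /= /addnI h; rewrite (qs_fix hs).
    + move=> [u v] /=; rewrite ltn_add2l eqxx => lt; split.
        by rewrite (qs_move Q2 hs) // ltn_eqF.
      move=> [u' v'] /= /orP[/andP[/eqP<- F]|/andP[F /eqP<-]]; rewrite ltn_add2l => lt'.
        by rewrite (qs_cross hs lt lt' F).
      by lia.
  have [s hs] := qr_refl Q1 E; exists (fun u => (s u.1, u.2)); split=> /=.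
  + by move=> [u v] /=; rewrite (qs_inv hs).
  + by move=> u v; rewrite (qs_iso hs).
  + by rewrite (qs_x hs).
  + by move=> [u v] /= /addIn h; rewrite (qs_fix hs).
  + move=> [u v] /=; rewrite ltn_add2r eqxx => lt; split.
      by rewrite (qs_move Q1 hs) ?orbT // ltn_eqF.
    move=> [u' v'] /= /orP[/andP[/eqP<- F]|/andP[F /eqP<-]]; rewrite ltn_add2r => lt'.
      by lia.
    by rewrite (qs_cross hs lt lt' F).
Qed.

Lemma geodesic_prod (G H : Defs.fgraph) q1 q2 :
  geodesic (@fadj G) q1 -> geodesic (@fadj H) q2 ->
  geodesic (@fadj (gprod G H)) (fun u v => q1 u.1 v.1 + q2 u.2 v.2).
Proof.
move=> G1 G2 [a b] [c d] /=; have [<-|ne _] := eqVneq a c.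
  have [->|ne _] := eqVneq b d; first by rewrite eqxx.
  have [w ew qw] := G2 _ _ ne; exists (a, w); rewrite /= ?eqxx ?ew //; lia.
have [w ew qw] := G1 _ _ ne; exists (w, b); rewrite /= ?eqxx ?ew ?orbT //; lia.
Qed.

(** * The parallelogram identity and the action of reflections near a vertex *)

Section Parallelogram.
Variables (T : finType) (e : rel T) (q : T -> T -> nat).
Hypotheses (Q : qreflective e q) (G : geodesic e q).

Lemma qr_fold s x y u v : qreflection e q x y s -> q u y <= q u x -> q v x < q v y ->
  q u (s v) <= q u v.
Proof.
move=> hs hu hv; have C := geodesic_connect Q G.
rewrite (qr_within Q) //; apply: (within_fold Q hs) => //.
by rewrite -(qr_within Q).
Qed.

(* For the square p, a, s b, b the reflections along the two opposite edges
   pa and b(s b) have the same half-spaces. *)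
Lemma qr_parallelogram p a b s v : e p a -> e p b -> q a b = 2 ->
  qreflection e q p a s -> q v (s b) + q v p = q v b + q v a.
Proof.
move=> epa epb qab hs.
have qpa := qr_edge Q epa; have qpb := qr_edge Q epb.
have qba : q b a = 2 by rewrite (qr_sym Q).
have qbp : q b p = 1 by rewrite (qr_sym Q).
have ebw : e b (s b) by apply: (qs_move Q hs); rewrite qbp qba.
have [t ht] := qr_refl Q ebw.
have tp : t p = a.
  apply/esym/(qs_cross ht) => //; first by rewrite qpb (qr_sym Q) (qs_sx hs) qba.
  by rewrite qab (qr_sym Q) (qs_sy hs) qbp.
(* If [v] is equidistant from one of the two opposite edges, the corresponding reflection fixes [v],
   and it exchanges the ends of the other edge too. *)
have [/(qs_fix ht) tv|] := q v b =P q v (s b).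
  have : q v p = q v a by rewrite -{1}tv -(qs_inv ht p) (qs_iso ht) tp.
  have := qs_fixP ht tv; lia.
have [/[dup] qv /(qs_fix hs) sv|] := q v p =P q v a.
  by rewrite -[in q v (s b)]sv (qs_iso hs) qv.
(* Now both differences are 1 or -1, and folding across the edge [pa] shows that their signs
   agree. *)
have := qr_lip Q v epa; have := qr_lip Q v ebw.
have := @qr_lip _ _ _ Q a p v; rewrite (qr_esym Q) epa => /(_ isT).
have := @qr_lip _ _ _ Q (s b) b v; rewrite (qr_esym Q) ebw => /(_ isT).
have [lt|le] := ltnP (q v p) (q v a).
  have := @qr_fold s p a (s v) b hs.
  rewrite (qs_sx hs) (qs_sy hs) (qs_iso hs) qba qbp => /(_ (ltnW lt) isT).
  have -> : q (s v) b = q v (s b) by rewrite -{1}(qs_inv hs b) (qs_iso hs).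
  lia.
have := @qr_fold s p a v b hs le.
rewrite qba qbp => /(_ isT); lia.
Qed.

Lemma qs_square p a b s v : e p a -> e p b -> q a b = 2 ->
  qreflection e q p a s -> q (s v) b + q v p = q v b + q v a.
Proof.
move=> h1 h2 h3 hs; rewrite -(qr_parallelogram v h1 h2 h3 hs).
by rewrite -{1}(qs_inv hs b) (qs_iso hs).
Qed.

(** With [qs_square] this covers every neighbour [b] of [p] other than [a], so [q (s v) b] is known
    from the values of [q v] and from whether [a] and [b] are adjacent. *)
Lemma qs_triangle p a b s v : e p a -> e p b -> e a b ->
  qreflection e q p a s -> q (s v) b = q v b.
Proof.
move=> h1 h2 h3 hs; have sb : s b = b.
  by apply: (qs_fix hs); rewrite !(qr_sym Q b) !(qr_edge Q).
by rewrite -{1}sb (qs_iso hs).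
Qed.

End Parallelogram.

(** * Reconstruction of a connected graph from the neighbourhood of one vertex *)

Section LocalUnique.
Variables (U : finType) (eU : rel U).

(* The profile of v is the map a |-> q(v, a) - q(v, p) on the neighbours a
   of p; v and v' are matched when they have equal profiles. The profile of
   s_{pa}(v) depends only on the profile of v and on the local graph. *)
Definition same_profile (T T' : finType) (q : T -> T -> nat) (q' : T' -> T' -> nat)
    p p' (psi : U -> T) (psi' : U -> T') v v' :=
  forall a, q v (psi a) + q' v' p' = q' v' (psi' a) + q v p.

Section TwoGraphs.
Variables (T : finType) (e : rel T) (q : T -> T -> nat).
Variables (T' : finType) (e' : rel T') (q' : T' -> T' -> nat).
Hypotheses (Q : qreflective e q) (G : geodesic e q).
Hypotheses (Q' : qreflective e' q') (G' : geodesic e' q').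
Variables (p : T) (p' : T') (psi : U -> T) (psi' : U -> T').
Hypotheses (L : localiso eU e p psi) (L' : localiso eU e' p' psi').

Local Notation R := (same_profile q q' p p' psi psi').

Lemma local_q2 (W : finType) (eW : rel W) qW pW (phi : U -> W) a b :
  qreflective eW qW -> localiso eU eW pW phi -> a != b -> ~~ eU a b ->
  qW (phi a) (phi b) = 2.
Proof.
move=> QW LW ne nad.
have := qr_lip QW (phi a) (li_adj LW b : eW pW (phi b)).
have := @qr_lip _ _ _ QW (phi b) pW (phi a).
rewrite (qr_esym QW) (li_adj LW) => /(_ isT).
rewrite (qr_sym QW (phi a) pW) (qr_edge QW (li_adj LW a)).
have := qr_eq0 QW (phi a) (phi b); have := qr_eq1 QW (phi a) (phi b).
rewrite (inj_eq (li_inj LW)) (negPf ne) (li_edge LW) (negPf nad); lia.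
Qed.

Lemma local_q a b : q (psi a) (psi b) = q' (psi' a) (psi' b).
Proof.
have [->|ne] := eqVneq a b; first by rewrite (qr_xx Q) (qr_xx Q').
have [ad|nad] := boolP (eU a b).
  by rewrite (qr_edge Q) ?(qr_edge Q') ?(li_edge L) ?(li_edge L').
by rewrite (local_q2 Q L) ?(local_q2 Q' L').
Qed.

Lemma same_profile_base : R p p'.
Proof.
by move=> a; rewrite (qr_xx Q) (qr_xx Q') (qr_edge Q (li_adj L a)) (qr_edge Q' (li_adj L' a)).
Qed.

Lemma same_profile_local a : R (psi a) (psi' a).
Proof.
move=> b; rewrite local_q (qr_sym Q _ p) (qr_sym Q' _ p').
by rewrite (qr_edge Q (li_adj L a)) (qr_edge Q' (li_adj L' a)).
Qed.

Lemma same_profile_refl a s s' v v' :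
  qreflection e q p (psi a) s -> qreflection e' q' p' (psi' a) s' ->
  R v v' -> R (s v) (s' v').
Proof.
move=> hs hs' h b; rewrite (qs_sx hs) (qs_sx hs').
have la := li_adj L a; have lb := li_adj L b.
have la' := li_adj L' a; have lb' := li_adj L' b.
have := h a; have := h b.
have [<-|ne] := eqVneq a b; first by rewrite (qs_sy hs) (qs_sy hs'); lia.
have [ad|nad] := boolP (eU a b).
  rewrite (qs_triangle Q v la lb _ hs) ?(li_edge L) //.
  rewrite (qs_triangle Q' v' la' lb' _ hs') ?(li_edge L') //; lia.
have := qs_square Q G v la lb (local_q2 Q L ne nad) hs.
have := qs_square Q' G' v' la' lb' (local_q2 Q' L' ne nad) hs'.
lia.
Qed.

Lemma local_step v : v != p -> exists a, q v (psi a) < q v p.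
Proof.
rewrite eq_sym => /G[w epw]; have [a ->] := li_sur L epw.
by move=> E; exists a; rewrite !(qr_sym Q v) -E.
Qed.

(** A neighbour [a] of [p] closer to [v] than [p] gives a reflection taking [v] closer to [p]; a
    match of the image is reflected back in the other graph. *)
Lemma same_profile_total v : exists v', R v v'.
Proof.
move E: (q v p) => n; elim/ltn_ind: n v E => n IH v E.
have [->|/local_step[a]] := eqVneq v p; first by exists p'; exact: same_profile_base.
rewrite E => lt.
have [s hs] := qr_refl Q (li_adj L a); have [s' hs'] := qr_refl Q' (li_adj L' a).
have [v' hv'] := IH _ lt (s v) (qs_sx hs v).
by exists (s' v'); rewrite -(qs_inv hs v); exact: same_profile_refl hs hs' hv'.
Qed.
End TwoGraphs.

Section Uniqueness.
Variables (T : finType) (e : rel T) (q : T -> T -> nat).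
Variables (T' : finType) (e' : rel T') (q' : T' -> T' -> nat).
Hypotheses (Q : qreflective e q) (G : geodesic e q).
Hypotheses (Q' : qreflective e' q') (G' : geodesic e' q').
Variables (p : T) (p' : T') (psi : U -> T) (psi' : U -> T').
Hypotheses (L : localiso eU e p psi) (L' : localiso eU e' p' psi').

Local Notation R := (same_profile q q' p p' psi psi').

(** Reflections bring [v1] to [p']. Then [v2] has the profile of [p'], so no neighbour of [p'] is
    closer to [v2] than [p'] is, which forces [v2 = p']. *)
Lemma same_profile_inj v v1 v2 : R v v1 -> R v v2 -> v1 = v2.
Proof.
move E: (q' v1 p') => n; elim/ltn_ind: n v v1 v2 E => n IH v v1 v2 E h1 h2.
have [E1|ne] := eqVneq v1 p'.
  have [->|/(local_step Q' G' L')[a lt]] := eqVneq v2 p'; first by [].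
  have := h1 a; have := h2 a.
  by rewrite E1 (qr_xx Q') (qr_edge Q' (li_adj L' a)); lia.
have [a lt] := local_step Q' G' L' ne.
have [s hs] := qr_refl Q (li_adj L a); have [s' hs'] := qr_refl Q' (li_adj L' a).
rewrite E in lt.
have := IH _ lt (s v) (s' v1) (s' v2) (qs_sx hs' v1).
have step := same_profile_refl Q G Q' G' L L' hs hs'.
move=> /(_ (step _ _ h1) (step _ _ h2)).
exact: (inv_inj (qs_inv hs')).
Qed.

(** Reflections bring [v] to [p]. Then [w] is some [psi a], and injectivity identifies the matches
    as [p'] and [psi' a], which are adjacent. *)
Lemma same_profile_edge v w v' w' : R v v' -> R w w' -> e v w -> e' v' w'.
Proof.
move E: (q v p) => n; elim/ltn_ind: n v w v' w' E => n IH v w v' w' E h1 h2 evw.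
have [E1|/(local_step Q G L)[a lt]] := eqVneq v p.
  rewrite {}E1 in h1 evw; have [a Ea] := li_sur L evw; subst w.
  rewrite (same_profile_inj h1 (same_profile_base Q Q' L L')).
  by rewrite (same_profile_inj h2 (same_profile_local Q Q' L L' a)) (li_adj L').
have [s hs] := qr_refl Q (li_adj L a); have [s' hs'] := qr_refl Q' (li_adj L' a).
have step := same_profile_refl Q G Q' G' L L' hs hs'.
rewrite E in lt.
rewrite -(qs_edge Q' hs').
apply: IH lt (s v) (s w) _ _ (qs_sx hs v) (step _ _ h1) (step _ _ h2) _.
by rewrite (qs_edge Q hs).
Qed.
End Uniqueness.

Lemma local_unique (T : finType) (e : rel T) q (T' : finType) (e' : rel T') q' p p'
    (psi : U -> T) (psi' : U -> T') :
  qreflective e q -> geodesic e q -> qreflective e' q' -> geodesic e' q' ->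
  localiso eU e p psi -> localiso eU e' p' psi' -> giso (FGraph e) (FGraph e').
Proof.
move=> Q G Q' G' L L'.
pose R := same_profile q q' p p' psi psi'.
pose R' := same_profile q' q p' p psi' psi.
have RR' v v' : R v v' -> R' v' v by move=> h a; rewrite -h addnC.
have R'R v v' : R' v' v -> R v v' by move=> h a; rewrite -h addnC.
have [f hf] := fin_all_exists (same_profile_total Q G Q' G' L L').
have [g hg] := fin_all_exists (same_profile_total Q' G' Q G L' L).
have fK v : g (f v) = v.
  exact: (same_profile_inj Q' G' Q G L' L (hg (f v)) (RR' _ _ (hf v))).
have gK v : f (g v) = v.
  exact: (same_profile_inj Q G Q' G' L L' (hf (g v)) (R'R _ _ (hg v))).
exists f; split; first by exists g.
move=> u v /=; apply/idP/idP.
  exact: (same_profile_edge Q' G' Q G L' L (RR' _ _ (hf u)) (RR' _ _ (hf v))).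
exact: (same_profile_edge Q G Q' G' L L' (hf u) (hf v)).
Qed.

End LocalUnique.

(** * Graphs embedded in integer lattices: Johnson graphs and halved cubes *)

Section Embedded.
Import GRing.Theory Num.Theory.
Local Open Scope ring_scope.
Variables (T I : finType) (e : rel T) (q : T -> T -> nat).
Variables (emb : T -> I -> int) (c : nat).
Hypothesis c_gt0 : (0 < c)%N.
Hypothesis emb_inj : forall u v, emb u =1 emb v -> u = v.
Hypothesis emb_q : forall u v,
  \sum_i (emb u i - emb v i) ^+ 2 = (2 * c * q u v)%:Z.
Hypothesis q_edge : forall u v, e u v = (q u v == 1%N).
Hypothesis q_lip : forall x y w, e x y -> (q w x <= (q w y).+1)%N.
Hypothesis q_completion : forall x y w, e x y -> (q w x < q w y)%N ->
  exists w', forall i, emb w' i = emb w i + emb y i - emb x i.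

(* Since |x - y|^2 = 2c, the reflection in the hyperplane equidistant from x
   and y is w |-> w - (q(w, y) - q(w, x)) (x - y). *)
Lemma embedded_qreflective : qreflective e q.
Proof.
have qxx u : q u u = 0%N.
  have := emb_q u u; rewrite big1 => [|i _]; last by rewrite subrr expr0n.
  by move=> h; nia.
have q0 u v : q u v = 0%N -> u = v.
  move=> h; apply: emb_inj => i; have := emb_q u v; rewrite h muln0 => /eqP.
  rewrite psumr_eq0 => [/allP/(_ i)|j _]; last exact: sqr_ge0.
  by rewrite mem_index_enum sqrf_eq0 subr_eq0 => /(_ isT)/eqP.
have qC u v : q u v = q v u.
  have : (2 * c * q u v)%:Z = (2 * c * q v u)%:Z.
    by rewrite -!emb_q; apply: eq_bigr => i _; ring.
  nia.
split=> //.
  by move=> u v; apply/eqP/eqP => [/q0|->].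
move=> x y exy.
have qxy : q x y = 1%N by apply/eqP; rewrite -q_edge.
have eyx : e y x by rewrite q_edge qC qxy.
pose t w := (q w y)%:Z - (q w x)%:Z.
(* By the Lipschitz bound [t w] is 1, -1 or 0: complete the parallelogram along [xy], along [yx], or
   keep [w]. *)
have /fin_all_exists[s hs] : forall w, exists w',
    forall i, emb w' i = emb w i - t w * (emb x i - emb y i).
  move=> w; have := q_lip w exy; have := q_lip w eyx; rewrite /t.
  case: (ltngtP (q w x) (q w y)) => h l1 l2.
  - have [w' hw'] := q_completion exy h; exists w' => i.
    have -> : (q w y)%:Z = (q w x)%:Z + 1 by lia.
    by rewrite hw'; ring.
  - have [w' hw'] := q_completion eyx h; exists w' => i.
    have -> : (q w x)%:Z = (q w y)%:Z + 1 by lia.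
    by rewrite hw'; ring.
  - by exists w => i; rewrite h; ring.
(* Polarisation: the inner product of [u - v] and [x - y] is [c (t u - t v)]. Taking [k = t u - t v]
   gives the isometry, and [k = 1] gives the two edge conditions. *)
have sE u v k : \sum_i (emb u i - emb v i - k * (emb x i - emb y i)) ^+ 2 =
    (2 * c)%:Z * ((q u v)%:Z - k * (t u - t v) + k ^+ 2).
  transitivity (\sum_i ((emb u i - emb v i) ^+ 2 -
     k * ((emb u i - emb y i) ^+ 2 - (emb u i - emb x i) ^+ 2 -
         (emb v i - emb y i) ^+ 2 + (emb v i - emb x i) ^+ 2)
     + k ^+ 2 * (emb x i - emb y i) ^+ 2)).
    by apply: eq_bigr => i _; ring.
  rewrite big_split /= sumrB -!mulr_sumr big_split /= !sumrB !emb_q qxy /t !PoszM.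
  by ring.
have iso u v : q (s u) (s v) = q u v.
  have : (2 * c * q (s u) (s v))%:Z = (2 * c * q u v)%:Z.
    rewrite -emb_q; transitivity (\sum_i (emb u i - emb v i
                                  - (t u - t v) * (emb x i - emb y i)) ^+ 2).
      by apply: eq_bigr => i _; rewrite !hs; ring.
    by rewrite sE PoszM; ring.
  nia.
have sx : s x = y.
  apply: emb_inj => i; rewrite hs /t qxy qxx; ring.
have sy : s y = x.
  apply: emb_inj => i; rewrite hs /t qC qxy qxx; ring.
exists s; split=> //.
- move=> u; apply: emb_inj => i; rewrite !hs /t.
  have -> : q (s u) y = q u x by rewrite -sx iso.
  have -> : q (s u) x = q u y by rewrite -[X in q _ X = _]sy iso.
  ring.
- by move=> u E; apply: emb_inj => i; rewrite hs /t E; ring.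
- move=> u lt; have tu : t u = 1 by have := q_lip u eyx; rewrite /t; lia.
  split=> [|v euv lt'].
    rewrite q_edge; have := sE u u 1.
    rewrite qxx subrr (eq_bigr (fun i => (emb u i - emb (s u) i) ^+ 2)); last first.
      by move=> i _; rewrite hs tu; ring.
    by rewrite emb_q; nia.
  have tv : t v = -1 by have := q_lip v exy; rewrite /t; lia.
  have := sE u v 1; rewrite tu tv.
  have /eqP -> : q u v == 1%N by rewrite -q_edge.
  rewrite (eq_bigr (fun i => (emb v i - emb (s u) i) ^+ 2)); last first.
    by move=> i _; rewrite hs tu; ring.
  rewrite emb_q => h; apply: q0; nia.
Qed.

End Embedded.

(** * Families of sets with half the Hamming distance *)

Section SetFamily.
Variable I : finType.

Definition symdiff (A B : {set I}) := [set i | (i \in A) != (i \in B)].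

Lemma symdiffC A B : symdiff A B = symdiff B A.
Proof. by apply/setP => i; rewrite !inE eq_sym. Qed.

Lemma card_symdiff A B : #|symdiff A B| + 2 * #|A :&: B| = #|A| + #|B|.
Proof.
have -> : symdiff A B = (A :\: B) :|: (B :\: A).
  by apply/setP => i; rewrite !inE; case: (i \in A); case: (i \in B).
rewrite cardsU (_ : (A :\: B) :&: (B :\: A) = set0) ?cards0; last first.
  by apply/setP => i; rewrite !inE; case: (i \in A); case: (i \in B).
have := cardsID B A; have := cardsID A B; rewrite (setIC B A); lia.
Qed.

(** If [C] differed from [A] at [i], passing from [A] to [B] would repair [i] and spoil at most the
    one other point of difference, so [B] would be no farther from [C] than [A]. *)
Lemma symdiff_agree (A B C : {set I}) i : #|symdiff A B| = 2 ->
  #|symdiff C A| < #|symdiff C B| -> (i \in A) != (i \in B) -> (i \in C) = (i \in A).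
Proof.
move=> h lt iab; apply/eqP; apply: contraLR lt => ica; rewrite -leqNgt.
have ia : i \in symdiff C A by rewrite inE.
have ib : i \in symdiff A B by rewrite inE.
apply: (@leq_trans #|(symdiff C A :\ i) :|: (symdiff A B :\ i)|).
  apply/subset_leq_card/subsetP => j; rewrite !inE.
  have [->|_] := eqVneq j i; last by case: (j \in C); case: (j \in A); case: (j \in B).
  by move: iab ica; case: (i \in C); case: (i \in A); case: (i \in B).
have := cardsD1 i (symdiff C A); have := cardsD1 i (symdiff A B).
rewrite ia ib h cardsU; lia.
Qed.

Lemma card_sum_mem (A : {set I}) : #|A| = \sum_i (i \in A).
Proof. by rewrite -sum1_card big_mkcond. Qed.

Variables (T : finType) (e : rel T) (S : T -> {set I}).
Local Notation hd u v := #|symdiff (S u) (S v)|.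
Hypothesis S_inj : injective S.
Hypothesis S_edge : forall u v, e u v = (hd u v == 2).
Hypothesis S_even : forall u v, ~~ odd (hd u v).
Hypothesis S_completion : forall x y w (A : {set I}),
  (forall i, (i \in A) + (i \in S x) = (i \in S w) + (i \in S y)) ->
  exists w', S w' = A.

Lemma hdE u v : 2 * (hd u v)./2 = hd u v.
Proof. by have := S_even u v; lia. Qed.

(** The squared Euclidean distance of two indicator vectors is the Hamming distance, so [c = 1].
    Where [x] and [y] differ, a vertex [w] closer to [x] agrees with [x]; hence [w + y - x] is again
    an indicator vector. *)
Lemma set_family_qreflective : qreflective e (fun u v => (hd u v)./2).
Proof.
apply: (@embedded_qreflective _ I _ _ (fun u i => Posz (i \in S u)) 1) => //.
- move=> u v h; apply: S_inj; apply/setP => i; have := h i.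
  by case: (i \in S u); case: (i \in S v).
- move=> u v; rewrite muln1 hdE -sum1_card (big_morph Posz PoszD (erefl (Posz 0))).
  rewrite [RHS]big_mkcond /=; apply: eq_bigr => i _.
  by rewrite !inE; case: (i \in S u); case: (i \in S v).
- by move=> u v; rewrite S_edge; have := hdE u v; lia.
- move=> x y w; rewrite S_edge => /eqP h.
  have : hd w x <= hd w y + hd x y.
    rewrite -cardsUI (leq_trans _ (leq_addr _ _)) // subset_leq_card //.
    apply/subsetP => i; rewrite !inE.
    by case: (i \in S w); case: (i \in S x); case: (i \in S y).
  by have := hdE w x; have := hdE w y; lia.
- move=> x y w; rewrite S_edge => /eqP h lt.
  have {}lt : hd w x < hd w y by have := hdE w x; have := hdE w y; lia.
  have sub i : (i \in S x) != (i \in S y) -> (i \in S w) = (i \in S x).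
    exact: symdiff_agree h lt.
  have [|w' hw'] := @S_completion x y w [set i | if (i \in S x) != (i \in S y)
                                     then i \in S y else i \in S w].
    by move=> i; rewrite inE; case: eqP => [->|/eqP/sub->]; rewrite addnC.
  exists w' => i; rewrite hw' inE.
  by case: eqP => [->|/eqP/sub->] /=; lia.
Qed.

Lemma set_family_geodesic :
  (forall u v, u != v -> exists i j, exists2 w, [/\ i != j, i \in symdiff (S u) (S v)
     & j \in symdiff (S u) (S v)] & forall k, (k \in S w) =
     if (k == i) || (k == j) then k \in S v else k \in S u) ->
  geodesic e (fun u v => (hd u v)./2).
Proof.
move=> H u v /H[i [j [w [ij iD jD] hw]]]; exists w.
  rewrite S_edge -(_ : [set i; j] = symdiff (S u) (S w)) ?cards2 ?ij //.
  apply/setP => k; rewrite !inE hw; case: (eqVneq k i) => [->|ki].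
    by move: iD; rewrite inE.
  case: (eqVneq k j) => [->|kj]; last by rewrite eqxx.
  by move: jD; rewrite inE.
have := cardsD1 i (symdiff (S u) (S v)).
have := cardsD1 j (symdiff (S u) (S v) :\ i).
rewrite iD in_setD1 jD eq_sym ij.
rewrite (_ : symdiff (S u) (S v) :\ i :\ j = symdiff (S w) (S v)).
  by have := hdE u v; have := hdE w v; lia.
apply/setP => k; rewrite !inE hw; case: (eqVneq k i) => [->|ki] /=.
  by rewrite eqxx andbF.
by case: (eqVneq k j) => [->|kj] //=; rewrite eqxx.
Qed.

End SetFamily.

Definition set_dist (I : finType) (A B : {set I}) := #|symdiff A B|./2.

(** * Johnson graphs *)

Lemma johnson_symdiff n k (u v : johnson_vert n k) :
  #|symdiff (val u) (val v)| = 2 * (k - #|val u :&: val v|).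
Proof.
have := card_symdiff (val u) (val v); have := subset_leq_card (subsetIl (val u) (val v)).
by rewrite (eqP (valP u)) (eqP (valP v)); lia.
Qed.

Lemma johnson_edge n k (u v : johnson_vert n k) :
  @fadj (johnson n k) u v = (#|symdiff (val u) (val v)| == 2).
Proof.
rewrite johnson_symdiff /=; have := subset_leq_card (subsetIl (val u) (val v)).
by rewrite (eqP (valP u)); lia.
Qed.

Lemma johnson_even n k (u v : johnson_vert n k) : ~~ odd #|symdiff (val u) (val v)|.
Proof. by rewrite johnson_symdiff; lia. Qed.

Lemma johnson_qreflective n k :
  qreflective (@fadj (johnson n k)) (fun u v => set_dist (val u) (val v)).
Proof.
apply: set_family_qreflective; [exact: val_inj|exact: johnson_edge|exact: johnson_even|].
move=> x y w A hA; suff h : #|A| == k by exists (exist _ A h).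
have : \sum_i ((i \in A) + (i \in val x)) = \sum_i ((i \in val w) + (i \in val y)).
  by apply: eq_bigr.
rewrite !big_split /= -!card_sum_mem.
rewrite (eqP (valP x)) (eqP (valP y)) (eqP (valP w)) => /addIn->; exact: eqxx.
Qed.

Lemma johnson_geodesic n k :
  geodesic (@fadj (johnson n k)) (fun u v => set_dist (val u) (val v)).
Proof.
apply: set_family_geodesic; [exact: johnson_edge|exact: johnson_even|].
move=> u v; rewrite -val_eqE => ne.
have cuv : #|val u| = #|val v| by rewrite (eqP (valP u)) (eqP (valP v)).
have : ~~ (val u \subset val v) by apply: contra ne => h; rewrite eqEcard h cuv /=.
move=> /subsetPn[i iu iv].
have : ~~ (val v \subset val u).
  by apply: contra ne => h; rewrite eq_sym eqEcard h cuv /=.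
move=> /subsetPn[j jv ju].
have ij : i != j by apply: contraNneq ju => <-.
have h : #|j |: (val u :\ i)| == k.
  rewrite cardsU1 !inE (negPf ju) andbF /=.
  by have := cardsD1 i (val u); rewrite iu (eqP (valP u)) => <-.
exists i, j; exists (exist _ (j |: (val u :\ i)) h).
  by rewrite !inE iu jv (negPf iv) (negPf ju).
move=> l /=; rewrite !inE; case: (eqVneq l i) => [->|_] /=.
  by rewrite (negPf iv) (negPf ij).
by case: (eqVneq l j) => [->|_] //=.
Qed.

(** * Halved cubes, with binary words read as subsets *)

Definition hcube_set n (u : hcube_vert n) : {set 'I_n} := [set i | val u i].

Lemma hcube_set_even n (u : hcube_vert n) : ~~ odd #|hcube_set u|.
Proof. exact: valP u. Qed.

Lemma hcube_set_inj n : injective (@hcube_set n).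
Proof.
move=> u v h; apply/val_inj/ffunP => i.
by have := congr1 (fun A : {set 'I_n} => i \in A) h; rewrite !inE.
Qed.

Lemma hcube_set_sur n (A : {set 'I_n}) : ~~ odd #|A| -> exists u, @hcube_set n u = A.
Proof.
move=> h; have h' : ~~ odd #|[set i | [ffun i => i \in A] i]|.
  by rewrite (_ : [set i | _] = A) //; apply/setP => i; rewrite inE ffunE.
exists (exist (fun x : {ffun 'I_n -> bool} => ~~ odd #|[set i | x i]|) _ h').
by apply/setP => i; rewrite inE ffunE.
Qed.

Lemma hcube_edge n (u v : hcube_vert n) :
  @fadj (halved_cube n) u v = (#|symdiff (hcube_set u) (hcube_set v)| == 2).
Proof.
by rewrite /=; congr (_ == _); apply: eq_card => i; rewrite !inE.
Qed.

Lemma hcube_even n (u v : hcube_vert n) : ~~ odd #|symdiff (hcube_set u) (hcube_set v)|.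
Proof.
have := card_symdiff (hcube_set u) (hcube_set v); have := hcube_set_even u.
by have := hcube_set_even v; lia.
Qed.

Lemma hcube_qreflective n : qreflective (@fadj (halved_cube n))
  (fun u v => set_dist (hcube_set u) (hcube_set v)).
Proof.
apply: set_family_qreflective; [exact: hcube_set_inj|exact: hcube_edge|exact: hcube_even|].
move=> x y w A hA; apply: hcube_set_sur.
have : \sum_i ((i \in A) + (i \in hcube_set x)) =
       \sum_i ((i \in hcube_set w) + (i \in hcube_set y)) by apply: eq_bigr.
rewrite !big_split /= -!card_sum_mem.
have := hcube_set_even x; have := hcube_set_even y; have := hcube_set_even w.
move: #|A| #|hcube_set x| #|hcube_set y| #|hcube_set w|; lia.
Qed.

Lemma hcube_geodesic n : geodesic (@fadj (halved_cube n))
  (fun u v => set_dist (hcube_set u) (hcube_set v)).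
Proof.
apply: set_family_geodesic; [exact: hcube_edge|exact: hcube_even|].
move=> u v; rewrite -(inj_eq (@hcube_set_inj n)) => ne.
have D0 : symdiff (hcube_set u) (hcube_set v) != set0.
  apply: contra ne => /eqP D0; apply/eqP/setP => i; apply/eqP.
  have : i \notin symdiff (hcube_set u) (hcube_set v) by rewrite D0 inE.
  by rewrite inE negbK.
have := hcube_even u v; have := D0; rewrite -card_gt0 => c0 ev.
have /card_gt1P[i [j [iD jD ij]]] : 1 < #|symdiff (hcube_set u) (hcube_set v)| by lia.
pose A := [set k | if (k == i) || (k == j) then k \in hcube_set v else k \in hcube_set u].
have sd : symdiff (hcube_set u) A = [set i; j].
  apply/setP => k; rewrite !inE; case: (eqVneq k i) => [->|ki].
    by move: iD; rewrite !inE.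
  case: (eqVneq k j) => [->|kj]; last by rewrite eqxx.
  by move: jD; rewrite !inE.
have [|w hw] := @hcube_set_sur n A.
  have := card_symdiff (hcube_set u) A; rewrite sd cards2 ij; have := hcube_set_even u; lia.
by exists i, j; exists w => // k; rewrite hw inE.
Qed.

(** * Cocktail party graphs and the Gosset graph *)

Definition cocktail_dist k (u v : 'I_k * bool) :=
  if u.1 != v.1 then 1 else if u.2 == v.2 then 0 else 2.

Lemma cocktail_qreflective k : qreflective (@fadj (cocktail k)) (@cocktail_dist k).
Proof.
split.
- by move=> [i a] [j b]; rewrite /cocktail_dist xpair_eqE /=;
     case: (eqVneq i j) => _ //; case: (eqVneq a b).
- by move=> [i a] [j b]; rewrite /cocktail_dist /=; case: (eqVneq i j) => _ //; case: (eqVneq a b).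
- by move=> [i a] [j b]; rewrite /cocktail_dist /= eq_sym (eq_sym a).
- move=> [i a] [j b] [l c] /=; rewrite /cocktail_dist /=.
  by case: (eqVneq l i) => [->|_]; case: (eqVneq _ j) => // _; case: ifP.
move=> [i a] [j b] /= ij.
(* Exchange the pairs [i] and [j], flipping the sign on both when [a] and [b] differ, so that
   [(i, a)] goes to [(j, b)]. *)
exists (fun u => (tperm i j u.1, u.2 (+) ((u.1 \in [set i; j]) && (a (+) b)))).
have tm l : (tperm i j l \in [set i; j]) = (l \in [set i; j]).
  by rewrite !inE; case: tpermP => [->|->|/eqP/negPf-> /eqP/negPf->];
     rewrite ?eqxx ?orbT ?(negPf ij) //=; rewrite eq_sym (negPf ij).
split.
- by move=> [l c] /=; rewrite tpermK tm -addbA addbb addbF.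
- move=> [l c] [m d]; rewrite /cocktail_dist /= (inj_eq perm_inj).
  by case: (eqVneq l m) => [->|//] /=; case: c; case: d; case: (_ && _).
- by rewrite /= tpermL !inE eqxx /= addbA addbb.
- move=> [l c]; rewrite /cocktail_dist /= !inE.
  case: (eqVneq l i) => [->|li] /=; first by rewrite ij; case: (c == a).
  case: (eqVneq l j) => [->|lj] /=; first by case: (c == b).
  by rewrite tpermD 1?eq_sym //= addbF.
- move=> [l c]; rewrite /cocktail_dist /= !inE.
  case: (eqVneq l i) => [->|li] /=.
    rewrite ij tpermL; case: (eqVneq c a) => // -> _; split=> // -[m d] /=.
    case: (eqVneq m i) => [->|mi] //=.
    case: (eqVneq m j) => [->|mj] //= _; case: (eqVneq d b) => // -> _.
    by rewrite addbA addbb.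
  case: (eqVneq l j) => [->|lj] //=.
  rewrite tpermR; case: (eqVneq c b) => // cb _; split; first by rewrite eq_sym.
  move=> [m d] /=; case: (eqVneq m j) => [->|mj] //=.
  case: (eqVneq m i) => [->|mi] //= _; case: (eqVneq d a) => // da _.
  by move: cb da; case: c; case: b; case: d; case: a.
Qed.

(** The bound excludes [CP(1)], which consists of two isolated vertices; for larger [k] a third
    vertex joins the two members of a pair. *)
Lemma cocktail_geodesic k : 1 < k -> geodesic (@fadj (cocktail k)) (@cocktail_dist k).
Proof.
move=> k1 [i a] [j b]; rewrite xpair_eqE /cocktail_dist /=.
case: (eqVneq i j) => [<-|ij] /=.
  move=> /negPf->; have : 0 < #|[set~ i]| by rewrite cardsC1 card_ord; lia.
  move=> /card_gt0P[l]; rewrite !inE => li.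
  by exists (l, a); rewrite /= ?li // eq_sym.
by move=> _; exists (j, b); rewrite //= !eqxx.
Qed.

(** * Local graphs and diameter two *)

Section Local.
Variables (T : finType) (e : rel T) (q : T -> T -> nat) (p : T).
Hypothesis Q : qreflective e q.

(** Both ends of an edge of the local graph are at distance 1 from [p], so its reflection fixes [p]
    and preserves the neighbours of [p]. *)
Lemma local_qreflective :
  @qreflective {v | e p v} (fun u v => e (val u) (val v)) (fun u v => q (val u) (val v)).
Proof.
apply: qreflective_sub Q _ => x y s px py exy hs u pu.
have sp : s p = p by apply: (qs_fix hs); rewrite !(qr_edge Q).
by rewrite -{1}sp (qs_edge Q hs).
Qed.

Lemma local_leq2 u v : e p u -> e p v -> q u v <= 2.
Proof.
move=> pu pv; have := @qr_lip _ _ _ Q v p u.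
by rewrite (qr_esym Q) pv (qr_sym Q u p) (qr_edge Q pu); apply.
Qed.

Lemma localiso_val : @localiso {v | e p v} (fun u v => e (val u) (val v)) T e p val.
Proof.
split=> //; first exact: val_inj; first by move=> a; exact: valP.
by move=> b pb; exists (exist _ b pb).
Qed.

End Local.

Lemma diameter2_geodesic (T : finType) (e : rel T) q : qreflective e q ->
  (forall u v, q u v <= 2) ->
  (forall u v, u != v -> ~~ e u v -> exists2 w, e u w & e w v) -> geodesic e q.
Proof.
move=> Q q2 H u v ne; have [euv|nuv] := boolP (e u v).
  by exists v => //; rewrite (qr_xx Q) (qr_edge Q).
have [w uw wv] := H u v ne nuv; exists w => //; rewrite (qr_edge Q wv).
by have := q2 u v; have := qr_eq0 Q u v; have := qr_eq1 Q u v; rewrite (negPf ne) (negPf nuv); lia.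
Qed.

(** * The Gosset graph as a lattice configuration *)

Definition gosset_dist (u v : gosset_vert) :=
  if u.2 == v.2 then 2 - #|val u.1 :&: val v.1| else #|val u.1 :&: val v.1|.+1.

Section Gosset.

Definition gosset_emb (u : gosset_vert) (i : 'I_8) : int :=
  ((-1) ^+ u.2 * (Posz (4 * (i \in val u.1)) - 1))%R.

Lemma card_sumZ (A : {set 'I_8}) : Posz #|A| = (\sum_i Posz (i \in A))%R.
Proof. by rewrite card_sum_mem (big_morph Posz PoszD (erefl (Posz 0))). Qed.

Lemma gosset_capC (u v : gosset_vert) : #|val u.1 :&: val v.1| = #|val v.1 :&: val u.1|.
Proof. by rewrite setIC. Qed.

Lemma gosset_card (u : gosset_vert) : #|val u.1| = 2.
Proof. exact/eqP/(valP u.1). Qed.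

Lemma gosset_cap_leq (u v : gosset_vert) : #|val u.1 :&: val v.1| <= 2.
Proof.
by have := subset_leq_card (subsetIl (val u.1) (val v.1)); rewrite gosset_card.
Qed.

(** The vectors have squared length 24 and adjacent ones have inner product 8, so an edge has
    squared length 32, whence [c = 16]. Distance 3 occurs for opposite vectors, the same pair in the
    two copies. *)
Lemma gosset_emb_dist u v :
  (\sum_i (gosset_emb u i - gosset_emb v i) ^+ 2 = Posz (2 * 16 * gosset_dist u v))%R.
Proof.
have := gosset_cap_leq u v; rewrite /gosset_dist /gosset_emb.
case: (eqVneq u.2 v.2) => [->|uv] le.
  transitivity (\sum_i (16 * (Posz (i \in val u.1) + Posz (i \in val v.1)
                        - 2 * Posz (i \in val u.1 :&: val v.1))))%R.
    apply: eq_bigr => i _; rewrite inE.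
    by case: (v.2); case: (i \in val u.1); case: (i \in val v.1).
  rewrite -GRing.mulr_sumr GRing.sumrB big_split /= -GRing.mulr_sumr -!card_sumZ.
  by rewrite !gosset_card; move: #|_ :&: _| le; lia.
transitivity (\sum_(i < 8) (32 * Posz (i \in val u.1 :&: val v.1) + 4))%R.
  apply: eq_bigr => i _; rewrite inE.
  by move: uv; case: (u.2); case: (v.2) => //; case: (i \in val u.1); case: (i \in val v.1).
rewrite big_split /= -GRing.mulr_sumr -card_sumZ GRing.sumr_const card_ord.
by move: #|_ :&: _|; lia.
Qed.

Lemma gosset_edge u v : gosset_adj u v = (gosset_dist u v == 1).
Proof.
rewrite /gosset_adj /gosset_dist; case: ifP => _.
  have := gosset_cap_leq u v; lia.
by rewrite eqSS cards_eq0 setI_eq0.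
Qed.

Lemma gosset_vert_of (A : {set 'I_8}) b : #|A| = 2 ->
  exists2 u : gosset_vert, val u.1 = A & u.2 = b.
Proof. by move=> /eqP h; exists (exist _ A h, b). Qed.

Lemma gosset_symdiff (u v : gosset_vert) :
  #|symdiff (val u.1) (val v.1)| = 4 - 2 * #|val u.1 :&: val v.1|.
Proof.
by have := card_symdiff (val u.1) (val v.1); rewrite !gosset_card; lia.
Qed.

(** Within a copy, adjacent pairs differ by one exchange, which changes the intersection with [w] by
    at most one. Across copies the pairs are disjoint, so their intersections with [w] have total
    size at most 2. *)
Lemma gosset_lip x y w : gosset_adj x y -> gosset_dist w x <= (gosset_dist w y).+1.
Proof.
have lx := gosset_cap_leq w x; have ly := gosset_cap_leq w y.
rewrite /gosset_adj; case: (eqVneq x.2 y.2) => [E|ne].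
  move=> /eqP h.
  have le (a b : gosset_vert) : #|val a.1 :&: val b.1| = 1 ->
      #|val w.1 :&: val a.1| <= #|val w.1 :&: val b.1|.+1.
    move=> hab; apply: (@leq_trans #|(val w.1 :&: val b.1) :|: (val a.1 :\: val b.1)|).
      apply/subset_leq_card/subsetP => i; rewrite !inE.
      by case: (i \in val w.1); case: (i \in val a.1); case: (i \in val b.1).
    rewrite cardsU; have := cardsID (val b.1) (val a.1); rewrite hab gosset_card; lia.
  have := le x y h; have := le y x; rewrite gosset_capC h => /(_ erefl).
  by rewrite /gosset_dist E; case: ifP => _;
     move: #|val w.1 :&: val x.1| #|val w.1 :&: val y.1|; clear; lia.
move=> /pred0P/= dis.
have : #|val w.1 :&: val x.1| + #|val w.1 :&: val y.1| <= #|val w.1|.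
  rewrite -cardsUI (_ : _ :&: _ :&: _ = set0) ?cards0 ?addn0; last first.
    by apply/setP => i; have := dis i; rewrite /= !inE; case: (i \in val w.1).
  by apply/subset_leq_card/subsetP => i; rewrite !inE; case: (i \in val w.1).
rewrite gosset_card.
rewrite /gosset_dist; move: ne; case: (x.2); case: (y.2); case: (w.2) => //= _; lia.
Qed.

(* The four cases are those of the signs of y and w relative to that of x. *)
Lemma gosset_completion x y w : gosset_adj x y -> gosset_dist w x < gosset_dist w y ->
  exists w', forall i,
    gosset_emb w' i = (gosset_emb w i + gosset_emb y i - gosset_emb x i)%R.
Proof.
have swap (a b : gosset_vert) : #|symdiff (val a.1) (val b.1)| = 2 ->
    #|symdiff (val w.1) (val a.1)| < #|symdiff (val w.1) (val b.1)| ->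
    exists2 w' : gosset_vert, w'.2 = w.2 & forall i,
      (i \in val w'.1) + (i \in val a.1) = (i \in val w.1) + (i \in val b.1).
  move=> h lt; pose A := [set i | if (i \in val a.1) != (i \in val b.1)
                                  then i \in val b.1 else i \in val w.1].
  have hA i : (i \in A) + (i \in val a.1) = (i \in val w.1) + (i \in val b.1).
    rewrite inE; case: ifP => [/(symdiff_agree h lt)->|/negbFE/eqP->]; lia.
  have [|w' hw1 hw2] := @gosset_vert_of A w.2; last first.
    by exists w' => // i; rewrite hw1.
  have : \sum_i ((i \in A) + (i \in val a.1)) = \sum_i ((i \in val w.1) + (i \in val b.1)).
    by apply: eq_bigr.
  by rewrite !big_split /= -!card_sum_mem !gosset_card => /addIn.
have lx := gosset_cap_leq w x; have ly := gosset_cap_leq w y.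
rewrite /gosset_adj /gosset_dist; case: (eqVneq x.2 y.2) => [E|ne].
  move=> /eqP h; rewrite E; case: ifP => /eqP wy lt.
    have [||w' hw1 hw2] := swap x y; rewrite ?gosset_symdiff ?h //; first lia.
    exists w' => i; have := hw2 i; rewrite /gosset_emb hw1 wy E.
    by case: (i \in val w'.1); case: (i \in val w.1);
       case: (i \in val x.1); case: (i \in val y.1); case: (y.2).
  (* Here [w] lies in the other copy; its vector has the opposite sign, so the roles of [x] and [y]
     are exchanged. *)
  have h' : #|val y.1 :&: val x.1| = 1 by rewrite gosset_capC.
  have [||w' hw1 hw2] := swap y x; rewrite ?gosset_symdiff ?h' //; first lia.
  exists w' => i; have := hw2 i; rewrite /gosset_emb hw1 E.
  by case: (i \in val w'.1); case: (i \in val w.1); case: (i \in val x.1);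
     case: (i \in val y.1); move: wy; case: (y.2); case: (w.2) => // /(_ erefl).
move=> dis; have dis' i : (i \in val x.1) && (i \in val y.1) = false.
  by have := pred0P dis i.
have cxy : #|val x.1 :|: val y.1| = 4.
  by rewrite cardsU !gosset_card (_ : _ :&: _ = set0) ?cards0 //;
     apply/eqP; rewrite setI_eq0.
have cw : #|val w.1 :&: (val x.1 :|: val y.1)| =
          #|val w.1 :&: val x.1| + #|val w.1 :&: val y.1|.
  rewrite setIUr -cardsUI (_ : _ :&: _ :&: _ = set0) ?cards0 ?addn0 //.
  by apply/setP => i; have := dis' i; rewrite !inE; case: (i \in val w.1).
have [E|ne'] := eqVneq w.2 x.2.
  rewrite E (negPf ne) => lt.
  have sub : val w.1 \subset val x.1 :|: val y.1.
    apply/setIidPl/eqP; rewrite eqEcard subsetIl cw gosset_card.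
    by move: lt; move: #|val w.1 :&: val x.1| #|val w.1 :&: val y.1|; clear; lia.
  (* As [w] is contained in the four points of [x] and [y], the remaining two of these form the
     completion. *)
  have [|w' hw1 hw2] := @gosset_vert_of ((val x.1 :|: val y.1) :\: val w.1) y.2.
    by rewrite cardsD cxy setIC (setIidPl sub) gosset_card.
  exists w' => i; rewrite /gosset_emb hw1 hw2 E !inE; have := dis' i.
  have := subsetP sub i; rewrite inE.
  case: (i \in val w.1); [move=> /(_ erefl)|move=> _];
    case: (i \in val x.1); case: (i \in val y.1) => //=;
    by move: ne; case: (x.2); case: (y.2).
have E : w.2 = y.2 by move: ne ne'; case: (x.2); case: (y.2); case: (w.2).
rewrite E eqxx => lt.
have w0 : val w.1 :&: (val x.1 :|: val y.1) = set0.
  apply/eqP; rewrite -cards_eq0 cw.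
  by move: lt; move: #|val w.1 :&: val x.1| #|val w.1 :&: val y.1|; clear; lia.
(* The three pairs are now pairwise disjoint, and the completion is the pair left over in the
   8-set. *)
have [|w' hw1 hw2] := @gosset_vert_of (~: (val w.1 :|: (val x.1 :|: val y.1))) x.2.
  by rewrite cardsCs setCK card_ord cardsU w0 cards0 cxy gosset_card.
exists w' => i; rewrite /gosset_emb hw1 hw2 !inE; have := dis' i.
have : i \notin val w.1 :&: (val x.1 :|: val y.1) by rewrite w0 inE.
rewrite E !inE; move: ne; case: (x.2); case: (y.2) => // _;
  by case: (i \in val w.1); case: (i \in val x.1); case: (i \in val y.1).
Qed.

Lemma gosset_qreflective : qreflective (@fadj gosset) gosset_dist.
Proof.
apply: (@embedded_qreflective _ _ _ _ gosset_emb 16) => //.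
- move=> [[A hA] a] [[B hB] b] h.
  have E i : ((-1) ^+ a * (Posz (4 * (i \in A)) - 1))%R =
             ((-1) ^+ b * (Posz (4 * (i \in B)) - 1))%R by exact: h.
  have ab : a = b.
    have /card_gt0P[i iA] : 0 < #|A| by rewrite (eqP hA).
    by have := E i; rewrite iA; case: (i \in B); case: a {E h}; case: b.
  subst b; congr (_, _); apply/val_inj/setP => i /=.
  by have := E i; case: a {E h}; case: (i \in A); case: (i \in B).
- exact: gosset_emb_dist.
- exact: gosset_edge.
- exact: gosset_lip.
- exact: gosset_completion.
Qed.

End Gosset.

Lemma exists_subset_card (T : finType) (A : {set T}) k : k <= #|A| ->
  exists2 B : {set T}, B \subset A & #|B| = k.
Proof.
rewrite -bin_gt0 -cards_draws => /card_gt0P[B]; rewrite inE => /andP[h /eqP]; by exists B.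
Qed.

Lemma cap_pair (T : finType) (a b : T) (B : {set T}) : a != b ->
  #|[set a; b] :&: B| = (a \in B) + (b \in B).
Proof.
move=> ab; rewrite setIUl cardsU (_ : [set a] :&: B :&: ([set b] :&: B) = set0).
  have h x : #|[set x] :&: B| = (x \in B).
    case: (boolP (x \in B)) => hx; first by rewrite (setIidPl _) ?cards1 // sub1set.
    by apply/eqP; rewrite cards_eq0 setI_eq0 disjoints1.
  by rewrite !h cards0 subn0.
apply/setP => x; rewrite !inE; case: (eqVneq x a) => [->|//].
by rewrite (negPf ab) andbF.
Qed.

Lemma disjoint_pair (T : finType) (a b : T) (B : {set T}) :
  [disjoint [set a; b] & B] = (a \notin B) && (b \notin B).
Proof. by rewrite disjoints_subset subUset !sub1set !inE. Qed.

Section GossetSteps.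

Lemma gosset_pair (a b : 'I_8) (s : bool) : a != b ->
  exists2 u : gosset_vert, val u.1 = [set a; b] & u.2 = s.
Proof. by move=> ab; apply: gosset_vert_of; rewrite cards2 ab. Qed.

Lemma gosset_fresh (A : {set 'I_8}) : #|A| < 8 -> exists k, k \notin A.
Proof.
move=> h; have : 0 < #|~: A| by rewrite cardsCs setCK card_ord; lia.
by move=> /card_gt0P[k]; rewrite inE; exists k.
Qed.

Lemma gosset_geodesic : geodesic (@fadj gosset) gosset_dist.
Proof.
move=> u v ne; have [uv|nuv] := boolP (@fadj gosset u v).
  exists v => //; move: uv; rewrite /= gosset_edge => /eqP->.
  by rewrite (qr_xx gosset_qreflective).
have lc := gosset_cap_leq u v.
have [E|ns] := eqVneq u.2 v.2.
  have c0 : #|val u.1 :&: val v.1| = 0.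
    have := qr_eq0 gosset_qreflective u v; move: nuv; rewrite /= gosset_edge (negPf ne).
    by rewrite /gosset_dist E eqxx; move: #|_ :&: _| lc; lia.
  have dis i : ~~ ((i \in val u.1) && (i \in val v.1)).
    by move/eqP: c0; rewrite cards_eq0 => /eqP/setP/(_ i); rewrite !inE => ->.
  have /card_gt0P[a au] : 0 < #|val u.1| by rewrite gosset_card.
  have /card_gt0P[b bv] : 0 < #|val v.1| by rewrite gosset_card.
  have av : a \notin val v.1 by have := dis a; rewrite au.
  have bu : b \notin val u.1 by have := dis b; rewrite bv andbT.
  have ab : a != b by apply: contraNneq bu => <-.
  have [w w1 w2] := gosset_pair u.2 ab.
  exists w; first by rewrite /= /gosset_adj w2 eqxx setIC w1 cap_pair // au (negPf bu).
  by rewrite /gosset_dist w2 E eqxx c0 w1 cap_pair // bv (negPf av).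
have : ~~ [disjoint val u.1 & val v.1] by move: nuv; rewrite /= /gosset_adj (negPf ns).
rewrite -setI_eq0 => /set0Pn[i]; rewrite inE => /andP[iu iv].
have /card_gt0P[a] : 0 < #|val u.1 :\ i|.
  by have := cardsD1 i (val u.1); rewrite gosset_card iu add1n => -[<-].
rewrite !inE => /andP[ai au].
have [k] : exists k, k \notin val u.1 :|: val v.1.
  by apply: gosset_fresh; rewrite cardsU !gosset_card ltnS leq_subLR (leq_trans _ (leq_addl _ _)).
rewrite inE negb_or => /andP[ku kv].
have ak : a != k by apply: contraNneq ku => <-.
(* Replacing the common point [i] of [u] and [v] by a point outside both lowers the intersection by
   exactly one. *)
have [w w1 w2] := gosset_pair u.2 ak.
exists w; first by rewrite /= /gosset_adj w2 eqxx setIC w1 cap_pair // au (negPf ku).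
rewrite /gosset_dist w2 (negPf ns) w1 cap_pair // (negPf kv) addn0.
have -> : val u.1 = [set i; a].
  apply/esym/eqP; rewrite eqEcard gosset_card cards2 eq_sym ai /= andbT.
  by apply/subsetP => x; rewrite !inE => /orP[]/eqP->.
by rewrite cap_pair 1?eq_sym // iv.
Qed.

Definition base_set : {set 'I_8} := [set (@Ordinal 8 0 isT); (@Ordinal 8 1 isT)].

Lemma gosset_baseE (v : gosset_vert) : gosset_adj gosset_base v =
  if v.2 then [disjoint base_set & val v.1] else #|base_set :&: val v.1| == 1.
Proof. by rewrite /gosset_adj /=; case: v.2. Qed.

Lemma schlafli_geodesic : geodesic (@fadj schlafli)
  (fun u v => gosset_dist (val u) (val v)).
Proof.
have Q := local_qreflective gosset_base gosset_qreflective.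
apply: (diameter2_geodesic Q).
  by move=> u v; apply: (local_leq2 gosset_qreflective (valP u) (valP v)).
suff H (u v : gosset_vert) : gosset_adj gosset_base u -> gosset_adj gosset_base v ->
    u != v -> ~~ gosset_adj u v -> u.2 <= v.2 ->
    exists w, [/\ gosset_adj gosset_base w, gosset_adj u w & gosset_adj w v].
  have S := qr_esym gosset_qreflective.
  move=> [u pu] [v pv]; rewrite -val_eqE /= => ne nuv.
  have /orP[le|le] := leq_total u.2 v.2.
    by have [w [pw uw wv]] := H u v pu pv ne nuv le; exists (exist _ w pw).
  have [||w [pw vw wu]] := H v u pv pu _ _ le; first by rewrite eq_sym.
    by have := S v u; rewrite /= => ->.
  exists (exist _ w pw); rewrite /=; first by have := S u w; rewrite /= => ->.
  by have := S w v; rewrite /= => ->.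
move=> pu pv ne nuv; have lc := gosset_cap_leq u v.
have same : u.2 = v.2 -> [disjoint val u.1 & val v.1].
  move=> E; rewrite -setI_eq0 -cards_eq0.
  have := qr_eq0 gosset_qreflective u v; move: nuv; rewrite /= gosset_edge (negPf ne).
  by rewrite /gosset_dist E eqxx; move: #|_ :&: _| lc; clear; lia.
move: pu pv; rewrite !gosset_baseE.
(* The common neighbour takes a point from each of [u] and [v] if both lie in the second copy.
   Otherwise it takes the point that [u] shares with [base_set], together with a point outside all
   three sets, or with the point of [v] outside [base_set] if [v] lies in the first copy. *)
case u2: (u.2); case v2: (v.2) => // pu pv _.
- have dis := pred0P (same (etrans u2 (esym v2))).
  have /card_gt0P[a au] : 0 < #|val u.1| by rewrite gosset_card.
  have /card_gt0P[b bv] : 0 < #|val v.1| by rewrite gosset_card.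
  have av : a \notin val v.1 by have := dis a; rewrite /= au /= => ->.
  have bu : b \notin val u.1 by have := dis b; rewrite /= bv andbT => ->.
  have ab : a != b by apply: contraNneq bu => <-.
  have [w w1 w2] := gosset_pair true ab; exists w; split.
  + rewrite gosset_baseE w2 w1 disjoint_sym disjoint_pair.
    by rewrite (disjointFl pu au) (disjointFl pv bv).
  + by rewrite /gosset_adj u2 w2 setIC w1 cap_pair // au (negPf bu).
  + by rewrite /gosset_adj v2 w2 w1 cap_pair // bv (negPf av).
- have /card_gt0P[p] : 0 < #|base_set :&: val u.1| by rewrite (eqP pu).
  rewrite inE => /andP[pb pu1].
  have pv1 : p \notin val v.1 by rewrite (disjointFr pv pb).
  have [k] : exists k, k \notin base_set :|: (val u.1 :|: val v.1).
    have cb : #|base_set| = 2 by rewrite cards2.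
    apply: gosset_fresh; have := cardsU (val u.1) (val v.1).
    have := cardsU base_set (val u.1 :|: val v.1); rewrite !gosset_card cb => -> ->.
    by move: #|base_set :&: _| #|val u.1 :&: val v.1|; clear; lia.
  rewrite !inE !negb_or => /and3P[kb ku kv].
  have kb' : k \notin base_set by rewrite !inE negb_or.
  have pk : p != k by apply: contraNneq ku => <-.
  have [w w1 w2] := gosset_pair false pk; exists w; split.
  + by rewrite gosset_baseE w2 w1 setIC cap_pair // pb (negPf kb').
  + by rewrite /gosset_adj u2 w2 setIC w1 cap_pair // pu1 (negPf ku).
  + by rewrite /gosset_adj v2 w2 w1 disjoint_pair pv1 kv.
- have dis := same (etrans u2 (esym v2)).
  have /card_gt0P[p] : 0 < #|base_set :&: val u.1| by rewrite (eqP pu).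
  rewrite inE => /andP[pb pu1].
  have /card_gt0P[j] : 0 < #|val v.1 :\: base_set|.
    have := cardsID base_set (val v.1); rewrite setIC (eqP pv) gosset_card.
    by move: #|_ :\: _|; clear; lia.
  rewrite inE => /andP[jb jv].
  have pv1 : p \notin val v.1 by rewrite (disjointFr dis pu1).
  have ju : j \notin val u.1 by rewrite (disjointFl dis jv).
  have pj : p != j by apply: contraNneq ju => <-.
  have [w w1 w2] := gosset_pair false pj; exists w; split.
  + by rewrite gosset_baseE w2 w1 setIC cap_pair // pb (negPf jb).
  + by rewrite /gosset_adj u2 w2 setIC w1 cap_pair // pu1 (negPf ju).
  + by rewrite /gosset_adj v2 w2 w1 cap_pair // jv (negPf pv1).
Qed.

End GossetSteps.

(** * Local graphs of the basic graphs *)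

(* Restricting the parameters removes the coincidences among small members
   of the families, e.g. J(4,2) = CP(3), and the halved 4-cube = CP(4). *)
Definition reduced_code (c : basic_code) : bool :=
  match c with
  | CodeCP k => 2 < k
  | CodeJ n k => [&& 0 < k, 2 * k <= n & (k == 1) || (4 < n)]
  | CodeHalved n => 4 < n
  | CodeSchlafli => true
  | CodeGosset => true
  end.

Definition basic_local (U : finType) (eU : rel U) :=
  exists c, reduced_code c /\
  exists p psi, @localiso U eU _ (@fadj (graph_of_code c)) p psi.

Lemma localiso_comp (U U' T : finType) (eU : rel U) (eU' : rel U') (e : rel T) p
    (f : U -> U') psi :
  bijective f -> (forall u v, eU' (f u) (f v) = eU u v) ->
  localiso eU' e p psi -> localiso eU e p (psi \o f).
Proof.
move=> [g fK gK] fe L; split => /=.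
- by move=> u v /(li_inj L)/(can_inj fK).
- by move=> a; exact: li_adj L _.
- by move=> b /(li_sur L)[a ->]; exists (g a); rewrite /= gK.
- by move=> a b; rewrite (li_edge L) fe.
Qed.

Lemma basic_local_comp (U U' : finType) (eU : rel U) (eU' : rel U') (f : U -> U') :
  bijective f -> (forall u v, eU' (f u) (f v) = eU u v) ->
  basic_local eU' -> basic_local eU.
Proof.
move=> bf fe [c [hc [p [psi L]]]]; exists c; split=> //; exists p, (psi \o f).
exact: localiso_comp L.
Qed.

Lemma cocktail_localiso k : exists p psi,
  localiso (@fadj (cocktail k)) (@fadj (cocktail k.+1)) p psi.
Proof.
exists (ord0, false), (fun u => (lift ord0 u.1, u.2)); split=> /=.
- move=> [i a] [j b] E; have /= -> := congr1 snd E.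
  by have /= /lift_inj-> := congr1 fst E.
- by move=> [i a]; exact: (@neq_lift k.+1 ord0 i).
- by move=> [i a] /= /unlift_some[j -> _]; exists (j, a).
- by move=> [i a] [j b] /=; rewrite (inj_eq (@lift_inj _ _)).
Qed.

Lemma set_param (T : finType) (A : {set T}) a : #|A| = a ->
  exists f : 'I_a -> T, injective f /\ forall x, x \in A <-> exists i, x = f i.
Proof.
move=> <-; exists enum_val; split; first exact: enum_val_inj.
move=> x; split=> [h|[i ->]]; last exact: enum_valP.
by exists (enum_rank_in h x); rewrite enum_rankK_in.
Qed.

Section Swap.
Variable T : finType.
Implicit Types (A : {set T}) (x y : T).

Definition swap A x y := y |: (A :\ x).

Lemma card_swap A x y : x \in A -> y \notin A -> #|swap A x y| = #|A|.
Proof.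
move=> xA yA; rewrite /swap cardsU1 !inE (negPf yA) andbF.
by rewrite (cardsD1 x A) xA.
Qed.

Lemma cap_swap A x y : y \notin A -> A :&: swap A x y = A :\ x.
Proof.
move=> yA; apply/setP => z; rewrite !inE; case: (eqVneq z y) => [->|_] /=.
  by rewrite (negPf yA) andbF.
by case: (z \in A); rewrite ?andbF.
Qed.

(** The intersection is [A] without [x] and [x'], plus the new point when [y = y']. So for distinct
    index pairs the two swaps are adjacent in the Johnson graph exactly when one coordinate
    agrees. *)
Lemma card_cap_swap A x y x' y' : x \in A -> x' \in A -> y \notin A -> y' \notin A ->
  #|swap A x y :&: swap A x' y'|.+1 + (x != x') = #|A| + (y == y').
Proof.
move=> xA xA' yA yA'.
have -> : swap A x y :&: swap A x' y' = (if y == y' then [set y] else set0) :|: (A :\ x :\ x').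
  apply/setP => z; rewrite !inE; case: (eqVneq y y') => [<-|yy']; rewrite !inE;
  case: (eqVneq z y) => [->|zy] //=; rewrite ?(negPf yA) ?andbF ?orbF ?(negPf yy') //.
    by case: (z \in A); case: (z == x); case: (z == x').
  case: (eqVneq z y') => [->|_] /=; first by rewrite (negPf yA') !andbF.
  by case: (z \in A); case: (z == x); case: (z == x').
have := cardsD1 x A; have := cardsD1 x' (A :\ x); rewrite xA !inE xA' andbT eq_sym => h1 h2.
case: (eqVneq y y') => [E|_]; last by rewrite set0U; lia.
by rewrite cardsU1 !inE (negPf yA) !andbF; lia.
Qed.

End Swap.

(** The rook's graph, the product of complete graphs on [a] and [b] vertices. *)
Definition rook a b (u v : 'I_a * 'I_b) : bool :=
  (u.1 == v.1) && (u.2 != v.2) || (u.1 != v.1) && (u.2 == v.2).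

(** A neighbour of the set [A] exchanges one of its [a] elements for one of the [b] elements
    outside. *)
Lemma rook_johnson a b : 0 < a -> exists p psi,
  localiso (@rook a b) (@fadj (johnson (a + b) a)) p psi.
Proof.
move=> a0; have [A _ cA] : exists2 A : {set 'I_(a + b)}, A \subset setT & #|A| = a.
  by apply: exists_subset_card; rewrite cardsT card_ord leq_addr.
have cA' : #|~: A| = b by rewrite cardsCs setCK card_ord cA addKn.
have [f [fi hf]] := set_param cA; have [g [gi hg]] := set_param cA'.
have fA i : f i \in A by apply/hf; exists i.
have gA i : g i \notin A by have : g i \in ~: A by [apply/hg; exists i]; rewrite inE.
have cs i j : #|swap A (f i) (g j)| == a by rewrite card_swap // cA.
exists (exist _ A (introT eqP cA)), (fun u => exist _ (swap A (f u.1) (g u.2)) (cs _ _)).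
have E u v : (#|swap A (f u.1) (g u.2) :&: swap A (f v.1) (g v.2)|.+1 == a) = rook u v.
  have := card_cap_swap (fA u.1) (fA v.1) (gA u.2) (gA v.2).
  rewrite (inj_eq fi) (inj_eq gi) cA /rook.
  move: #|_ :&: _| => c; case: (u.1 == v.1); case: (u.2 == v.2) => /=; lia.
split.
- move=> u v [] h; have := card_cap_swap (fA u.1) (fA v.1) (gA u.2) (gA v.2).
  rewrite h setIid card_swap // cA (inj_eq fi) (inj_eq gi).
  case: u v {h} => [u1 u2] [v1 v2] /=; case: (eqVneq u1 v1) => [->|_];
    case: (eqVneq u2 v2) => [->|_] //; lia.
- move=> u /=; rewrite cap_swap // -[X in _ == X]cA (cardsD1 (f u.1) A) fA //.
- move=> [B hB] /= /eqP h; have cB := eqP hB.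
  have /cards1P[x hx] : #|A :\: B| == 1.
    by have := cardsID B A; rewrite cA; move: h; move: #|_ :&: _| #|_ :\: _|; lia.
  have /cards1P[y hy] : #|B :\: A| == 1.
    have := cardsID A B; rewrite cB setIC; move: h; move: #|_ :&: _| #|_ :\: _|; lia.
  have : x \in A :\: B by rewrite hx inE.
  rewrite inE => /andP[xB xA]; have /hf[i Ei] := xA.
  have : y \in B :\: A by rewrite hy inE.
  rewrite inE => /andP[yA yB]; have /hg[j Ej] : y \in ~: A by rewrite inE.
  exists (i, j); apply: val_inj; rewrite /= -Ei -Ej; apply/setP => z.
  move/setP: hx => /(_ z); move/setP: hy => /(_ z); rewrite !inE.
  by case: (z \in A); case: (z \in B) => /= <- <-.
- by move=> u v /=; exact: E.
Qed.

(** Both graphs are the 4-cycle. This handles the case leading to [J(4,2)], which is not a reduced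
    code and is replaced by [CP(3)]. *)
Lemma rook22_cocktail : exists f : 'I_2 * 'I_2 -> 'I_2 * bool,
  bijective f /\ forall u v, @fadj (cocktail 2) (f u) (f v) = rook u v.
Proof.
pose f (u : 'I_2 * 'I_2) : 'I_2 * bool := (if u.1 == u.2 then ord0 else ord_max, u.1 == ord0).
pose g (u : 'I_2 * bool) : 'I_2 * 'I_2 :=
  let i := if u.2 then ord0 else ord_max in
  (i, if u.1 == ord0 then i else if u.2 then ord_max else ord0).
have H (i : 'I_2) : i = ord0 \/ i = ord_max.
  by case: i => -[|[|//]] h; [left|right]; apply: val_inj.
exists f; split.
  exists g => [[i j]|[i b]]; rewrite /f /g.
    by have [->|->] := H i; have [->|->] := H j.
  by have [->|->] := H i; case: b.
move=> [i j] [k l]; rewrite /f /rook /=.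
by have [->|->] := H i; have [->|->] := H j; have [->|->] := H k; have [->|->] := H l.
Qed.

Lemma basic_local_rook a b : 0 < a -> a <= b -> basic_local (@rook a b).
Proof.
move=> a0 ab; have [[Ea Eb]|ne] : (a = 2 /\ b = 2) \/ (a == 1) || (4 < a + b) by lia.
  subst a b; have [f [bf fe]] := rook22_cocktail.
  apply: basic_local_comp bf fe _; exists (CodeCP 3); split=> //.
  exact: cocktail_localiso.
exists (CodeJ (a + b) a); split; last exact: rook_johnson.
by rewrite /= a0 ne andbT; lia.
Qed.

Definition complete (T : finType) (e : rel T) := forall u v, e u v = (u != v).

Lemma basic_local_complete (T : finType) (e : rel T) : 0 < #|T| -> complete e -> basic_local e.
Proof.
move=> t0 ce; apply: (@basic_local_comp _ _ _ _ (fun u => (ord0 : 'I_1, enum_rank u)));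
  last exact: (@basic_local_rook 1 #|T|).
  exists (fun u => enum_val u.2) => [u|[i u]] /=; first exact: enum_rankK.
  by rewrite enum_valK (ord1 i).
by move=> u v; rewrite /rook eqxx orbF ce (inj_eq enum_rank_inj).
Qed.

Lemma basic_local_complete_prod (G H : Defs.fgraph) :
  0 < #|fvert G| -> 0 < #|fvert H| -> complete (@fadj G) -> complete (@fadj H) ->
  basic_local (@fadj (gprod G H)).
Proof.
move=> g0 h0 cG cH.
have adj (u v : fvert G * fvert H) : @fadj (gprod G H) u v =
    (u.1 == v.1) && (u.2 != v.2) || (u.1 != v.1) && (u.2 == v.2) by rewrite /= cG cH.
have [le|/ltnW le] := leqP #|fvert G| #|fvert H|.
  apply: (@basic_local_comp _ _ _ _ (fun u => (enum_rank u.1, enum_rank u.2)));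
    last exact: basic_local_rook le.
    exists (fun u => (enum_val u.1, enum_val u.2)) => [[u v]|[i j]] /=.
      by rewrite !enum_rankK.
    by rewrite !enum_valK.
  by move=> u v; rewrite adj /rook !(inj_eq enum_rank_inj).
apply: (@basic_local_comp _ _ _ _ (fun u => (enum_rank u.2, enum_rank u.1)));
  last exact: basic_local_rook le.
  exists (fun u => (enum_val u.2, enum_val u.1)) => [[u v]|[i j]] /=.
    by rewrite !enum_rankK.
  by rewrite !enum_valK.
by move=> u v; rewrite adj /rook !(inj_eq enum_rank_inj) orbC andbC (andbC (u.2 == _)).
Qed.

(** The neighbours of the zero word are the words of weight 2. *)
Lemma johnson2_hcube n : exists p psi,
  localiso (@fadj (johnson n 2)) (@fadj (halved_cube n)) p psi.
Proof.
have [|p hp] := @hcube_set_sur n set0; first by rewrite cards0.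
have /fin_all_exists[psi hpsi] (u : fvert (johnson n 2)) : exists w, @hcube_set n w = val u.
  by apply: hcube_set_sur; rewrite (eqP (valP u)).
have sd0 (A : {set 'I_n}) : symdiff set0 A = A.
  by apply/setP => i; rewrite !inE; case: (i \in A).
exists p, psi; split.
- by move=> u v E; apply: val_inj; rewrite -!hpsi E.
- by move=> u; rewrite hcube_edge hp sd0 hpsi; exact: valP u.
- move=> w; rewrite hcube_edge hp sd0 => h; exists (exist (fun A : {set 'I_n} => #|A| == 2) _ h).
  by apply: hcube_set_inj; rewrite hpsi.
- by move=> u v; rewrite hcube_edge johnson_edge !hpsi.
Qed.

(** * The halved 5-cube as the local graph of the Schläfli graph *)

Section HalvedCube5.

Definition shift3 (X : {set 'I_5}) : {set 'I_8} := @rshift 3 5 @: X.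
Let o0 : 'I_8 := @Ordinal 8 0 isT.
Let o1 : 'I_8 := @Ordinal 8 1 isT.
Let o2 : 'I_8 := @Ordinal 8 2 isT.

Lemma ord8_cases (i : 'I_8) : [\/ i = o0, i = o1, i = o2 | exists j, i = rshift 3 j].
Proof.
case: (@splitP 3 5 i) => [[[|[|[|//]]] h] /= E|j E].
- by apply: Or41; apply: val_inj.
- by apply: Or42; apply: val_inj.
- by apply: Or43; apply: val_inj.
- by apply: Or44; exists j; apply: val_inj.
Qed.

Lemma mem_shift3 X j : (rshift 3 j \in shift3 X) = (j \in X).
Proof. by rewrite /shift3 mem_imset //; exact: (@rshift_inj 3 5). Qed.

Lemma shift3_lt3 X (i : 'I_8) : i < 3 -> (i \in shift3 X) = false.
Proof. by move=> h; apply/negP => /imsetP[j _ E]; move: h; rewrite E. Qed.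

Lemma card_shift3 X : #|shift3 X| = #|X|.
Proof. by rewrite /shift3 card_imset //; exact: (@rshift_inj 3 5). Qed.

Lemma shift3I X Y : shift3 X :&: shift3 Y = shift3 (X :&: Y).
Proof. by rewrite /shift3 imsetI // => u v _ _; exact: (@rshift_inj 3 5). Qed.

(* The neighbours of {0,2} among the 27 neighbours of {0,1}, in terms of even
   subsets X of {3,..,7}: {1,2} for X empty, X in the second copy when |X| = 2,
   and {0,i} when X misses only i. *)
Definition hcube5_image (X : {set 'I_5}) (v : gosset_vert) :=
  [\/ [/\ #|X| = 0, val v.1 = [set o1; o2] & v.2 = false],
      [/\ #|X| = 2, val v.1 = shift3 X & v.2 = true] |
      [/\ #|X| = 4, val v.1 = o0 |: shift3 (~: X) & v.2 = false]].

Lemma hcube5_image_exists (x : hcube_vert 5) : exists v, hcube5_image (hcube_set x) v.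
Proof.
have := hcube_set_even x; have := max_card (mem (hcube_set x)); rewrite card_ord => le ev.
have : #|hcube_set x| = 0 \/ #|hcube_set x| = 2 \/ #|hcube_set x| = 4.
  by move: #|hcube_set x| le ev; lia.
case=> [h|[h|h]].
- have [|v v1 v2] := @gosset_vert_of [set o1; o2] false; first by rewrite cards2.
  by exists v; apply: Or31.
- have [|v v1 v2] := @gosset_vert_of (shift3 (hcube_set x)) true; first by rewrite card_shift3.
  by exists v; apply: Or32.
- have [|v v1 v2] := @gosset_vert_of (o0 |: shift3 (~: hcube_set x)) false.
    by rewrite cardsU1 shift3_lt3 // card_shift3 cardsCs setCK card_ord h.
  by exists v; apply: Or33.
Qed.

(** With [o1] this places the image in the Schläfli graph; with [o2] it makes the image a neighbour
    of the chosen vertex {0,2}. *)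
Lemma hcube5_image_adj X v (o : 'I_8) : o = o1 \/ o = o2 -> hcube5_image X v ->
  (if v.2 then [disjoint [set o0; o] & val v.1] else #|[set o0; o] :&: val v.1| == 1).
Proof.
have lt X' : o1 \in shift3 X' = false /\ o2 \in shift3 X' = false by rewrite !shift3_lt3.
case=> -> [] [_ -> ->]; rewrite ?disjoint_pair ?cap_pair // ?inE ?shift3_lt3 //.
Qed.

(** A pair in the second copy avoids 0, 1 and 2. One in the first copy meets both {0,1} and {0,2} in
    one point: either it contains 0 and neither 1 nor 2, or it is {1,2}. *)
Lemma hcube5_image_onto v : gosset_adj gosset_base v ->
  (if v.2 then [disjoint [set o0; o2] & val v.1] else #|[set o0; o2] :&: val v.1| == 1) ->
  exists X : {set 'I_5}, ~~ odd #|X| /\ hcube5_image X v.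
Proof.
rewrite gosset_baseE; pose Y : {set 'I_5} := [set j | rshift 3 j \in val v.1].
have cY : #|val v.1| = (o0 \in val v.1) + (o1 \in val v.1) + (o2 \in val v.1) + #|Y|.
  rewrite card_sum_mem (card_sum_mem Y) (@big_split_ord _ _ _ 3 5) /=; congr (_ + _).
    rewrite !big_ord_recl big_ord0 addn0 addnA.
    have -> : lshift 5 (ord0 : 'I_3) = o0 by exact: val_inj.
    have -> : lshift 5 (lift ord0 ord0 : 'I_3) = o1 by exact: val_inj.
    by have -> : lshift 5 (lift ord0 (lift ord0 ord0) : 'I_3) = o2 by exact: val_inj.
  by apply: eq_bigr => j _; rewrite inE.
rewrite gosset_card in cY.
case v2: (v.2); rewrite ?disjoint_pair ?cap_pair //.
  move=> /andP[h0 h1] /andP[_ h2]; exists Y.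
  have c2 : #|Y| = 2 by move: cY; rewrite (negPf h0) (negPf h1) (negPf h2).
  split; first by rewrite c2.
  apply: Or32; split=> //; apply/setP => i.
  have [->|->|->|[j ->]] := ord8_cases i; last by rewrite mem_shift3 inE.
  - by rewrite shift3_lt3 // (negPf h0).
  - by rewrite shift3_lt3 // (negPf h1).
  - by rewrite shift3_lt3 // (negPf h2).
move: cY; case h0: (o0 \in val v.1).
  case h1: (o1 \in val v.1) => //; case h2: (o2 \in val v.1) => // cY _ _.
  exists (~: Y); have c4 : #|~: Y| = 4 by rewrite cardsCs setCK card_ord; lia.
  split; first by rewrite c4.
  apply: Or33; split=> //; apply/setP => i; rewrite setCK in_setU1.
  have [->|->|->|[j ->]] := ord8_cases i; last by rewrite mem_shift3 inE -val_eqE.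
  - by rewrite eqxx h0.
  - by rewrite shift3_lt3 // h1.
  - by rewrite shift3_lt3 // h2.
case h1: (o1 \in val v.1) => //; case h2: (o2 \in val v.1) => // cY _ _.
exists set0; rewrite cards0; split=> //; apply: Or31; split=> //; first by rewrite cards0.
apply/esym/eqP; rewrite eqEcard gosset_card cards2 andbT.
by apply/subsetP => x; rewrite !inE => /orP[]/eqP->.
Qed.

(** Ordering the cardinals leaves six of the nine combinations of shapes; symmetry supplies the
    rest. *)
Lemma hcube5_image_edge_leq (X Y : {set 'I_5}) v w :
  hcube5_image X v -> hcube5_image Y w -> #|X| <= #|Y| ->
  gosset_adj v w = (#|symdiff X Y| == 2).
Proof.
have cXY := card_symdiff X Y; have := subset_leq_card (subsetIl X Y) => le.
have l1 Z : o1 \in shift3 Z = false by rewrite shift3_lt3.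
have l2 Z : o2 \in shift3 Z = false by rewrite shift3_lt3.
have n1 : (o1 == o0) = false by [].
have n2 : (o2 == o0) = false by [].
move=> [] [hX v1 v2] [] [hY w1 w2]; rewrite hX hY //= => _;
  rewrite /gosset_adj v1 v2 w1 w2 /=.
- by rewrite setIid cards2 /=; move: cXY le; rewrite hX hY;
    move: #|X :&: Y| #|symdiff X Y|; lia.
- by rewrite disjoint_pair l1 l2; move: cXY le; rewrite hX hY;
    move: #|X :&: Y| #|symdiff X Y|; lia.
- by rewrite cap_pair // !in_setU1 l1 l2 n1 n2; move: cXY le; rewrite hX hY;
    move: #|X :&: Y| #|symdiff X Y|; lia.
- by rewrite shift3I card_shift3; move: cXY le; rewrite hX hY;
    move: #|X :&: Y| #|symdiff X Y|; lia.
- rewrite -setI_eq0 setIUr (_ : shift3 X :&: [set o0] = set0); last first.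
    by apply/eqP; rewrite setI_eq0 disjoint_sym disjoints1 shift3_lt3.
  rewrite set0U shift3I -cards_eq0 card_shift3 -setDE.
  have := cardsID Y X; move: cXY le; rewrite hX hY.
  by move: #|X :\: Y| #|X :&: Y| #|symdiff X Y|; lia.
- rewrite -setUIr shift3I cardsU1 shift3_lt3 // card_shift3 -setCU cardsCs setCK card_ord.
  have := cardsUI X Y; have := max_card (mem (X :|: Y)); rewrite card_ord.
  by move: cXY le; rewrite hX hY; move: #|X :|: Y| #|X :&: Y| #|symdiff X Y|; lia.
Qed.

Lemma hcube5_image_edge (X Y : {set 'I_5}) v w :
  hcube5_image X v -> hcube5_image Y w -> gosset_adj v w = (#|symdiff X Y| == 2).
Proof.
move=> hX hY; have [le|/ltnW le] := leqP #|X| #|Y|; first exact: hcube5_image_edge_leq.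
rewrite symdiffC -(hcube5_image_edge_leq hY hX le); exact: (qr_esym gosset_qreflective).
Qed.

Lemma hcube5_schlafli : exists p psi,
  localiso (@fadj (halved_cube 5)) (@fadj schlafli) p psi.
Proof.
have [psi hpsi] := fin_all_exists hcube5_image_exists.
have [|p p1 p2] := @gosset_vert_of [set o0; o2] false; first by rewrite cards2.
have adjp v : gosset_adj p v =
    if v.2 then [disjoint [set o0; o2] & val v.1] else #|[set o0; o2] :&: val v.1| == 1.
  by rewrite /gosset_adj p1 p2; case: v.2.
have bp : gosset_adj gosset_base p.
  by rewrite gosset_baseE p2 p1 cap_pair // !inE.
have bpsi x : gosset_adj gosset_base (psi x).
  by rewrite gosset_baseE; apply: (hcube5_image_adj _ (hpsi x)); left.
exists (exist _ p bp), (fun x => exist _ (psi x) (bpsi x)); split.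
- move=> x y [] E; apply: hcube_set_inj.
  have := hpsi x; have := hpsi y; rewrite -E.
  have l1 Z : o1 \in shift3 Z = false by rewrite shift3_lt3.
  have l0 Z : o0 \in shift3 Z = false by rewrite shift3_lt3.
  move=> [] [hX v1 v2] [] [hY w1 w2]; move: w1 w2; rewrite ?v1 ?v2 // => w1 _.
  + by rewrite (cards0_eq hX) (cards0_eq hY).
  + by move/setP/(_ o0): w1; rewrite !inE.
  + by apply/setP => j; rewrite -mem_shift3 -w1 mem_shift3.
  + by move/setP/(_ o0): w1; rewrite !inE.
  + apply/setC_inj/setP => j; move/setP/(_ (rshift 3 j)): w1.
    by rewrite !in_setU1 -!val_eqE /= !mem_shift3.
- by move=> x /=; rewrite adjp; apply: (hcube5_image_adj _ (hpsi x)); right.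
- move=> [v bv] /=; rewrite adjp => pv.
  have [X [eX hX]] := hcube5_image_onto bv pv; have [x Ex] := hcube_set_sur eX.
  exists x; apply: val_inj => /=; have := hpsi x; rewrite Ex.
  move: hX => [] [hX v1 v2] [] [hX' w1 w2]; rewrite ?hX // in hX' *;
    by case: v v1 v2 {bv pv} => [v b] /= v1 ->; case: (psi x) w1 w2 => [w c] /= w1 ->;
       congr (_, _); apply: val_inj; rewrite /= v1 w1.
- by move=> x y; rewrite hcube_edge /=; exact: hcube5_image_edge.
Qed.

End HalvedCube5.

(** * The classification *)

Definition diameter2 (T : finType) (e : rel T) :=
  forall u v, u != v -> ~~ e u v -> exists2 w, e u w & e w v.

(** For [k = 1] the graph is complete and for [k = 2] it is local in a halved cube. For larger [k]
    there are two disjoint [k]-sets, and a common neighbour would meet each in [k - 1] points, which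
    is too many. *)
Lemma basic_local_johnson n k : reduced_code (CodeJ n k) ->
  diameter2 (@fadj (johnson n k)) -> basic_local (@fadj (johnson n k)).
Proof.
move=> /and3P[k0 kn kk] D.
have [A _ cA] : exists2 A : {set 'I_n}, A \subset setT & #|A| = k.
  by apply: exists_subset_card; rewrite cardsT card_ord; lia.
have u0 : fvert (johnson n k) := exist (fun A : {set 'I_n} => #|A| == k) A (introT eqP cA).
have [k1|k1] := eqVneq k 1.
  apply: basic_local_complete; first by apply/card_gt0P; exists u0.
  move=> u v; have -> : @fadj (johnson n k) u v = (#|val u :&: val v|.+1 == k) by [].
  have /cards1P[x Ex] : #|val u| == 1 by rewrite -k1; exact: valP u.
  have /cards1P[y Ey] : #|val v| == 1 by rewrite -k1; exact: valP v.
  rewrite -val_eqE Ex Ey k1 eqSS cards_eq0 setI_eq0.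
  by rewrite disjoints1 inE (inj_eq set1_inj).
move: kk; rewrite (negPf k1) /= => n4.
have [k2|k2] := eqVneq k 2.
  by rewrite k2; exists (CodeHalved n); split=> //; exact: johnson2_hcube.
have [B sB cB] : exists2 B : {set 'I_n}, B \subset ~: A & #|B| = k.
  by apply: exists_subset_card; rewrite cardsCs setCK card_ord cA; lia.
pose u : fvert (johnson n k) := exist (fun A : {set 'I_n} => #|A| == k) A (introT eqP cA).
pose v : fvert (johnson n k) := exist (fun A : {set 'I_n} => #|A| == k) B (introT eqP cB).
have AB : A :&: B = set0.
  by apply/eqP; rewrite setI_eq0 disjoint_sym -[A]setCK disjoints_subset setCK.
have [||[C hC] /= h1 h2] := D u v.
- rewrite -val_eqE /=; apply/eqP => E; move: AB; rewrite -E setIid => A0.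
  by move: k0; rewrite -cA A0 cards0.
- by rewrite /= AB cards0 eq_sym.
have : #|A :&: C| + #|C :&: B| <= #|C|.
  rewrite (setIC A) -cardsUI (_ : C :&: A :&: (C :&: B) = set0) ?cards0 ?addn0.
    by rewrite -setIUr subset_leq_card // subsetIl.
  by rewrite setIACA setIid AB setI0.
rewrite (eqP hC); move: h1 h2; move: #|A :&: C| #|C :&: B| => a b; lia.
Qed.

(** From [n = 6] on, the zero word and a word of weight 6 have no common neighbour. *)
Lemma basic_local_halved n : reduced_code (CodeHalved n) ->
  diameter2 (@fadj (halved_cube n)) -> basic_local (@fadj (halved_cube n)).
Proof.
move=> n4 D; rewrite /= in n4; have [n5|n5] := eqVneq n 5.
  by subst n; exists CodeSchlafli; split=> //; exact: hcube5_schlafli.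
have [B _ cB] : exists2 B : {set 'I_n}, B \subset setT & #|B| = 6.
  by apply: exists_subset_card; rewrite cardsT card_ord; lia.
have [|u hu] := @hcube_set_sur n set0; first by rewrite cards0.
have [|v hv] := @hcube_set_sur n B; first by rewrite cB.
have sd0 (A : {set 'I_n}) : symdiff set0 A = A.
  by apply/setP => i; rewrite !inE; case: (i \in A).
have [||w] := D u v.
- by apply/eqP => E; move: cB; rewrite -hv -E hu cards0.
- by rewrite hcube_edge hu hv sd0 cB.
rewrite !hcube_edge hu hv sd0 => /eqP h1 /eqP h2.
have := card_symdiff (hcube_set w) B; have := subset_leq_card (subsetIl (hcube_set w) B).
by rewrite h1 h2 cB; lia.
Qed.

(** The two copies of one pair have no common neighbour: it would have to meet the pair in one point
    and be disjoint from it. *)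
Lemma gosset_diameter : ~ diameter2 (@fadj gosset).
Proof.
move=> D; have [u u1 u2] := @gosset_vert_of base_set false (cards2 _ _).
have [v v1 v2] := @gosset_vert_of base_set true (cards2 _ _).
have nd : ~~ [disjoint base_set & base_set].
  by rewrite -setI_eq0 setIid -cards_eq0 cards2.
have [||w] := D u v.
- by apply/eqP => E; move: v2; rewrite -E u2.
- by rewrite /= /gosset_adj u1 v1 u2 v2.
rewrite /= /gosset_adj u1 v1 u2 v2.
by case: w.2 => /=; rewrite -setI_eq0 -cards_eq0 setIC => /eqP->.
Qed.

Lemma basic_local_code c : reduced_code c ->
  diameter2 (@fadj (graph_of_code c)) -> basic_local (@fadj (graph_of_code c)).
Proof.
case: c => [k|n k|n||] hc D.
- exists (CodeCP k.+1); split; first exact: ltnW.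
  exact: cocktail_localiso.
- exact: basic_local_johnson.
- exact: basic_local_halved.
- exists CodeGosset; split=> //; exists gosset_base, val; exact: localiso_val.
- by case: (gosset_diameter D).
Qed.

(** A factor with at least two vertices forces the complementary factor of a product of diameter 2
    to be complete. *)
Lemma reduced_code_pair c : reduced_code c ->
  exists u v : fvert (graph_of_code c), u != v.
Proof.
case: c => [k|n k|n||] /= hc.
- have k0 : 0 < k by lia.
  by exists (Ordinal k0, true), (Ordinal k0, false).
- move/and3P: hc => [k0 kn _].
  have [A _ cA] : exists2 A : {set 'I_n}, A \subset setT & #|A| = k.
    by apply: exists_subset_card; rewrite cardsT card_ord; lia.
  have /card_gt0P[x xA] : 0 < #|A| by rewrite cA.
  have /card_gt0P[y] : 0 < #|~: A| by rewrite cardsCs setCK card_ord cA; lia.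
  rewrite inE => yA; have cB : #|swap A x y| == k by rewrite card_swap // cA.
  exists (exist (fun A : {set 'I_n} => #|A| == k) A (introT eqP cA)).
  exists (exist (fun A : {set 'I_n} => #|A| == k) _ cB).
  rewrite -val_eqE /=; apply/eqP => E; move: yA; rewrite E !inE eqxx //.
- have [B _ cB] : exists2 B : {set 'I_n}, B \subset setT & #|B| = 2.
    by apply: exists_subset_card; rewrite cardsT card_ord; lia.
  have [|u hu] := @hcube_set_sur n set0; first by rewrite cards0.
  have [|v hv] := @hcube_set_sur n B; first by rewrite cB.
  by exists u, v; apply/eqP => E; move: cB; rewrite -hv -E hu cards0.
- have /card_gt1P[u [v [_ _ ne]]] : 1 < #|fvert (halved_cube 5)|.
    have [|u hu] := @hcube_set_sur 5 set0; first by rewrite cards0.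
    have [|v hv] := @hcube_set_sur 5 [set ord0; ord_max]; first by rewrite cards2.
    apply/card_gt1P; exists u, v; split=> //; apply/eqP => E.
    by have := cards2 (ord0 : 'I_5) ord_max; rewrite -hv -E hu cards0.
  have [p [psi L]] := hcube5_schlafli.
  by exists (psi u), (psi v); rewrite (inj_eq (li_inj L)).
- by exists gosset_base, (gosset_base.1, true); rewrite xpair_eqE andbF.
Qed.

Lemma gprod_list_inhabited s : all reduced_code s ->
  exists u : fvert (gprod_list (map graph_of_code s)), True.
Proof.
elim: s => [|c s IH] /=; first by exists tt.
by move=> /andP[/reduced_code_pair[u _] /IH[v _]]; exists (u, v).
Qed.

(** For [u], [v] distinct and non-adjacent, going from [(u, b)] to [(v, b')] takes at least two
    steps in the first factor and one in the second. *)
Lemma diameter2_prod_complete (G H : Defs.fgraph) (b b' : fvert H) :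
  irreflexive (@fadj G) -> diameter2 (@fadj (gprod G H)) -> b != b' -> complete (@fadj G).
Proof.
move=> irr D bb u v; case: (eqVneq u v) => [->|ne]; first exact: irr.
apply/negPn/negP => nuv; have [||[w1 w2]] := D (u, b) (v, b').
- by rewrite xpair_eqE (negPf ne).
- by rewrite /= (negPf ne) (negPf nuv).
rewrite /= => /orP[/andP[/eqP <- _]|/andP[h1 /eqP <-]].
  by rewrite (negPf ne) (negPf nuv).
by rewrite (negPf bb) andbF orbF => /andP[/eqP E _]; move: nuv; rewrite -E h1.
Qed.

Lemma diameter2_prod_completer (G H : Defs.fgraph) (a a' : fvert G) :
  irreflexive (@fadj H) -> diameter2 (@fadj (gprod G H)) -> a != a' -> complete (@fadj H).
Proof.
move=> irr D; apply: (@diameter2_prod_complete H G) => // -[b1 a1] [b2 a2] ne nad.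
have swapE x y x' y' :
    @fadj (gprod H G) (x, y) (x', y') = @fadj (gprod G H) (y, x) (y', x').
  by rewrite /= orbC andbC [in X in _ || X]andbC.
have [||[c d] h1 h2] := D (a1, b1) (a2, b2).
- by move: ne; rewrite !xpair_eqE andbC.
- by rewrite -swapE.
by exists (d, c); rewrite swapE.
Qed.

(** Valid for all parameters, including the disconnected [cocktail 1]; the geodesic property is
    established for reduced codes only. *)
Lemma code_qreflective c : exists q, qreflective (@fadj (graph_of_code c)) q.
Proof.
case: c => [k|n k|n||] /=; eexists.
- exact: cocktail_qreflective.
- exact: johnson_qreflective.
- exact: hcube_qreflective.
- exact: (local_qreflective gosset_base gosset_qreflective).
- exact: gosset_qreflective.
Qed.

Lemma reduced_code_qreflective c : reduced_code c ->
  exists q, qreflective (@fadj (graph_of_code c)) q /\ geodesic (@fadj (graph_of_code c)) q.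
Proof.
case: c => [k|n k|n||] /= hc; eexists; split.
- exact: cocktail_qreflective.
- by apply: cocktail_geodesic; lia.
- exact: johnson_qreflective.
- exact: johnson_geodesic.
- exact: hcube_qreflective.
- exact: hcube_geodesic.
- exact: (local_qreflective gosset_base gosset_qreflective).
- exact: schlafli_geodesic.
- exact: gosset_qreflective.
- exact: gosset_geodesic.
Qed.

Lemma K1_qreflective : qreflective (@fadj gK1) (fun _ _ => 0).
Proof. by split=> //; case; case. Qed.

Lemma list_qreflective s : exists q, qreflective (@fadj (gprod_list (map graph_of_code s))) q.
Proof.
elim: s => [|c s [q2 Q2]] /=; first by eexists; exact: K1_qreflective.
have [q1 Q1] := code_qreflective c; eexists; exact: (qreflective_prod Q1 Q2).
Qed.

Lemma reduced_list_qreflective s : all reduced_code s ->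
  exists q, qreflective (@fadj (gprod_list (map graph_of_code s))) q /\
            geodesic (@fadj (gprod_list (map graph_of_code s))) q.
Proof.
elim: s => [|c s IH] /=.
  by exists (fun _ _ => 0); split; [exact: K1_qreflective|case; case].
move=> /andP[/reduced_code_qreflective[q1 [Q1 G1]] /IH[q2 [Q2 G2]]].
eexists; split; first exact: (qreflective_prod Q1 Q2).
exact: geodesic_prod.
Qed.

(** The first factor has two vertices, so the product of the others is complete. If that product is
    a single vertex, the first factor is the whole graph; otherwise the first factor is complete
    too. The empty product is a complete graph on one vertex. *)
Lemma basic_local_prod s : all reduced_code s ->
  diameter2 (@fadj (gprod_list (map graph_of_code s))) ->
  basic_local (@fadj (gprod_list (map graph_of_code s))).
Proof.
case: s => [_ _|c s hcs].
  by apply: basic_local_complete; [rewrite card_unit|case; case].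
have /andP[hc hs] := hcs; rewrite /=.
have [b _] := gprod_list_inhabited hs.
have [qA QA] := code_qreflective c; have [qB QB] := list_qreflective s.
have [a [a' aa']] := reduced_code_pair hc.
move: b qA qB QA QB a a' aa'; set A := graph_of_code c; set B := gprod_list _.
move=> b qA qB QA QB a a' aa' D.
have cB := diameter2_prod_completer (qr_eirr QB) D aa'.
have [/existsP[b' bb']|] := boolP [exists b', b' != b].
  apply: basic_local_complete_prod => //; last exact: diameter2_prod_complete (qr_eirr QA) D bb'.
    by apply/card_gt0P; exists a.
  by apply/card_gt0P; exists b.
rewrite negb_exists => /forallP B1.
have {}B1 b' : b' = b by have /negPn/eqP := B1 b'.
apply: (@basic_local_comp _ _ _ (@fadj A) fst).
- by exists (fun a => (a, b)) => [[u v]|//]; rewrite /= (B1 v).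
- by move=> [u v] [u' v'] /=; rewrite (B1 v) (B1 v') (qr_eirr QB) eqxx andbF andbT.
apply: basic_local_code => // u v ne nuv.
have [||[w1 w2] /= h1 h2] := D (u, b) (v, b).
- by rewrite xpair_eqE negb_and ne.
- by rewrite /= (qr_eirr QB) andbF eqxx andbT.
move: h1 h2; rewrite (B1 w2) (qr_eirr QB) !andbF !eqxx !andbT.
by exists w1.
Qed.

Lemma card_sub_lt (T : finType) (P : pred T) x : ~~ P x -> #|{: {y | P y}}| < #|T|.
Proof.
move=> h; rewrite card_sig; apply: proper_card; apply/properP; split; first exact/subsetP.
by exists x => //; rewrite inE.
Qed.

Lemma card_sub_leq (T : finType) (P : pred T) : #|{: {y | P y}}| <= #|T|.
Proof. by rewrite card_sig; exact: max_card. Qed.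

Lemma giso_diameter2 (G H : Defs.fgraph) : giso G H -> diameter2 (@fadj G) -> diameter2 (@fadj H).
Proof.
move=> [f [[g fK gK] fe]] D u v ne nuv.
have [||w h1 h2] := D (g u) (g v).
- by rewrite (can_eq gK).
- by rewrite -fe !gK.
by exists (f w); [rewrite -[u]gK fe|rewrite -[v]gK fe].
Qed.

Lemma geodesic_diameter2 (T : finType) (e : rel T) q : qreflective e q -> geodesic e q ->
  (forall u v, q u v <= 2) -> diameter2 e.
Proof.
move=> Q G q2 u v ne nuv; have [w uw wv] := G u v ne; exists w => //.
have := q2 u v; have := qr_eq1 Q w v; have := qr_eq0 Q w v.
case: (eqVneq w v) => [E|_]; first by move: nuv; rewrite -E uw.
case: (e w v) => //; lia.
Qed.

(** * Disjoint unions as local graphs of products *)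

Section Union.
Variables (U : finType) (eU : rel U) (P : pred U).
Hypotheses (eU_sym : symmetric eU) (P_closed : forall u v, eU u v -> P u -> P v).

(** The neighbours of [(pG, pH)] differ from it in one coordinate, and two that differ in different
    coordinates are not adjacent. *)
Lemma localiso_union (G H : Defs.fgraph) pG pH
    (psiG : {u | P u} -> fvert G) (psiH : {u | ~~ P u} -> fvert H) :
  symmetric (@fadj G) -> irreflexive (@fadj G) ->
  symmetric (@fadj H) -> irreflexive (@fadj H) ->
  localiso (fun u v => eU (val u) (val v)) (@fadj G) pG psiG ->
  localiso (fun u v => eU (val u) (val v)) (@fadj H) pH psiH ->
  exists psi, localiso eU (@fadj (gprod G H)) (pG, pH) psi.
Proof.
move=> sG iG sH iH LG LH.
(* The value is specified for every proof of [P u] or of its negation, so that any proof at hand can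
   be used for rewriting. *)
have /fin_all_exists[psi hpsi] (u : U) : exists t,
    (forall h : P u, t = (psiG (exist _ u h), pH)) /\
    (forall h : ~~ P u, t = (pG, psiH (exist _ u h))).
  have [Pu|nPu] := orP (orbN (P u)).
    exists (psiG (exist _ u Pu), pH); split=> [h|h]; last by case/negP: (h).
    by rewrite (bool_irrelevance h Pu).
  exists (pG, psiH (exist _ u nPu)); split=> [h|h]; first by case/negP: nPu.
  by rewrite (bool_irrelevance h nPu).
have nG a : (psiG a == pG) = false.
  by apply/eqP => E; have := li_adj LG a; rewrite E iG.
have nH a : (psiH a == pH) = false.
  by apply/eqP => E; have := li_adj LH a; rewrite E iH.
have cross u v : P u -> ~~ P v -> eU u v = false.
  by move=> Pu Pv; apply/negP => /P_closed/(_ Pu) h; rewrite h in Pv.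
exists psi; split.
- move=> u v; have [hu1 hu2] := hpsi u; have [hv1 hv2] := hpsi v.
  have [Pu|Pu] := boolP (P u); have [Pv|Pv] := boolP (P v).
  + by rewrite (hu1 Pu) (hv1 Pv) => -[/(li_inj LG)[]].
  + by rewrite (hu1 Pu) (hv2 Pv) => -[E]; have := nG (exist _ u Pu); rewrite E eqxx.
  + by rewrite (hu2 Pu) (hv1 Pv) => -[_ E]; have := nH (exist _ u Pu); rewrite E eqxx.
  + by rewrite (hu2 Pu) (hv2 Pv) => -[/(li_inj LH)[]].
- move=> u; have [hu1 hu2] := hpsi u; have [Pu|Pu] := boolP (P u).
    by rewrite (hu1 Pu) /= eqxx (li_adj LG) orbT.
  by rewrite (hu2 Pu) /= eqxx (li_adj LH).
- move=> [x y] /= /orP[/andP[/eqP<- /(li_sur LH)[[u Pu] ->]]|/andP[/(li_sur LG)[[u Pu] ->] /eqP<-]].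
    by exists u; have [_ ->] := hpsi u.
  by exists u; have [-> _] := hpsi u.
- move=> u v; have [hu1 hu2] := hpsi u; have [hv1 hv2] := hpsi v.
  have [Pu|Pu] := boolP (P u); have [Pv|Pv] := boolP (P v).
  + by rewrite (hu1 Pu) (hv1 Pv) /= iH eqxx andbF andbT (li_edge LG).
  + by rewrite (hu1 Pu) (hv2 Pv) /= nG (eq_sym pH) nH andbF cross.
  + by rewrite (hu2 Pu) (hv1 Pv) /= (eq_sym pG) nG nH andbF eU_sym cross.
  + by rewrite (hu2 Pu) (hv2 Pv) /= iG eqxx orbF (li_edge LH).
Qed.
End Union.

(** A reflection moves a vertex only along an edge, so it preserves unions of components. *)
Lemma qreflective_closed (T : finType) (e : rel T) q (P : pred T) :
  qreflective e q -> (forall u v, e u v -> P u -> P v) ->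
  @qreflective {x | P x} (fun u v => e (val u) (val v)) (fun u v => q (val u) (val v)).
Proof.
move=> Q cl; apply: (qreflective_sub Q) => x y s _ _ _ hs u Pu.
have [/(qs_fix hs)-> //|/eqP ne] := q u x =P q u y.
exact: cl _ _ (qs_move Q hs ne) Pu.
Qed.

Lemma component_geodesic (T : finType) (e : rel T) q x : qreflective e q ->
  @geodesic {y | connect e x y} (fun u v => e (val u) (val v)) (fun u v => q (val u) (val v)).
Proof.
move=> Q [u xu] [v xv]; rewrite -val_eqE /= => ne.
have uv : connect e u v.
  by apply: connect_trans xv; rewrite (sym_connect_sym (qr_esym Q)).
have [w uw wv] := qr_step Q uv ne.
by exists (exist _ w (connect_trans xu (connect1 uw))).
Qed.

(* The component C of x is determined by its own local graph, to which the
   induction applies; as C has diameter at most 2, it is in turn the local graph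
   of a single basic graph. The other components are handled by induction. *)
Lemma local_classification (U : finType) (eU : rel U) q : qreflective eU q ->
  (forall u v, q u v <= 2) ->
  exists s, all reduced_code s /\
  exists p psi, localiso eU (@fadj (gprod_list (map graph_of_code s))) p psi.
Proof.
move E: #|U| => n; elim/ltn_ind: n U eU q E => n IH U eU q E Q q2.
have [U0|/card_gt0P[x _]] := posnP #|U|.
  exists [::]; split=> //; exists tt, (fun _ => tt).
  have no (u : U) : False := fintype0 u U0.
  by split=> // u; case: (no u).
pose P := connect eU x.
have P_closed u v : eU u v -> P u -> P v.
  by move=> uv xu; apply: connect_trans xu (connect1 uv).
have QC := qreflective_closed Q P_closed.
have QR : @qreflective {y | ~~ P y} _ _ := qreflective_closed Q (P := fun y => ~~ P y)
   (fun u v uv => contra (P_closed v u (etrans (qr_esym Q v u) uv))).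
have GC := component_geodesic Q (x := x).
have Px : P x by exact: connect0.
pose x0 : {y | P y} := exist _ x Px.
have [s0 [hs0 [p0 [psi0 L0]]]] : exists s, all reduced_code s /\
    exists p psi, @localiso {v : {y | P y} | eU x (val v)}
       (fun u v => eU (val (val u)) (val (val v)))
       _ (@fadj (gprod_list (map graph_of_code s))) p psi.
  apply: (IH _ _ _ _ _ erefl (local_qreflective x0 QC)) => //.
  (* The neighbours of [x0] do not include [x0], so the induction applies. *)
  rewrite -E; apply: leq_trans (card_sub_leq P).
  by apply: (@card_sub_lt _ _ x0); rewrite /= (qr_eirr Q).
have [q0 [Q0 G0]] := reduced_list_qreflective hs0.
have iso := local_unique QC GC Q0 G0 (localiso_val _ x0) L0.
have DC := geodesic_diameter2 QC GC (fun u v => q2 _ _).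
have [c [hc [pc [psic Lc]]]] := basic_local_prod hs0 (giso_diameter2 iso DC).
have [f [bf fe]] := iso; have {}Lc := localiso_comp bf fe Lc.
have [s [hs [ps [psis Ls]]]] : exists s, all reduced_code s /\
    exists p psi, @localiso {y | ~~ P y} (fun u v => eU (val u) (val v))
       _ (@fadj (gprod_list (map graph_of_code s))) p psi.
  apply: (IH _ _ _ _ _ erefl QR) => //.
  by rewrite -E; apply: (@card_sub_lt _ _ x); rewrite Px.
exists (c :: s); split; first by rewrite /= hc.
have [qc Qc] := code_qreflective c; have [qs Qs] := list_qreflective s.
have [psi L] := localiso_union (qr_esym Q) P_closed (qr_esym Qc) (qr_eirr Qc)
                  (qr_esym Qs) (qr_eirr Qs) Lc Ls.
by exists (pc, ps), psi.
Qed.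

Theorem theorem4p3 (T : finType) (e : rel T)
  (e_sym : symmetric e) (e_irr : irreflexive e) (e_conn : gconnected e) :
  reflective e <->
  exists s : seq basic_code,
    giso (@FGraph T e) (gprod_list (map graph_of_code s)).
Proof.
have [[p _] C] := e_conn; split=> [R|[s [f [bf fe]]]].
  have Q := reflective_qreflective e_sym e_irr C R.
  have [s [hs [p' [psi L]]]] := local_classification (local_qreflective p Q)
    (fun u v => local_leq2 Q (valP u) (valP v)).
  have [q' [Q' G']] := reduced_list_qreflective hs.
  exists s; exact: local_unique Q (qr_connected_geodesic Q C) Q' G' (localiso_val e p) L.
(* The codes are arbitrary here; connectedness, which makes the transported [q] the distance, is
   that of [e]. *)
have [q Q] := list_qreflective s.
exact: qreflective_reflective (qreflective_iso bf fe Q) C.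
Qed.
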